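(* Let $\mathcal B^c=(\mathcal B,\mathcal H)$ be the collared Bratteli diagram associated with a proper nested sequence of tilings $(T_n)_{n\in\mathbb N}$ of $\mathbb R^d$, and let $\Xi$ be the canonical transversal of the tiling space of $T_1$. The two equivalence relations $R_{\mathcal B}$ on $\partial\mathcal B$ and $R_\Xi$ on $\Xi$ are homeomorphic, $R_{\mathcal B}\cong R_\Xi$, and the homeomorphism is induced by the canonical homeomorphism $\varphi:\partial\mathcal B\to\Xi$ (that is, it is $(x,y)\mapsto(\varphi(x),\varphi(y))$).
   Context: **Tilings.** A tile is a compact subset of $\mathbb R^d$ equal to the closure of its interior; every tile is punctured (comes with a distinguished point of it, its puncture) and may carry a label; equality and translation of tiles respect punctures and labels. A patch is a finite set of tiles with pairwise disjoint interiors, whose union is its support; a tiling is a countable set of tiles with pairwise disjoint interiors and union $\mathbb R^d$. Tiles have finite CW-complex structures, and the intersection of two tiles of a tiling is a subcomplex of both. The inner (outer) radius of a tile or patch is the radius of the largest (smallest) ball centered at its puncture contained in (containing) its support. $T$ has FLC if for each $\rho>0$ there are finitely many patches of $T$ of outer radius $<\rho$ up to translation; it is repetitive if for each patch $p\subset T$ there is $\rho_p>0$ such that for every $x\in\mathbb R^d$ some translate of $p$ is a set of tiles of $T$ contained in $B(x,\rho_p)$; it is aperiodic if $T+a\ne T$ for all $a\neq0$. **Hull.** For tilings $T,T'$ let $\delta(T,T')=\min(\inf A,1)$, where $A$ is the set of $\varepsilon\in(0,1)$ for which there are $a,a'\in B(0,\varepsilon)$ such that $T+a$ and $T'+a'$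 have the same tiles with puncture in $B(0,1/\varepsilon)$. The tiling space $\Omega$ of $T_1$ is the closure of $\{T_1+a: a\in\mathbb R^d\}$, and the canonical transversal $\Xi\subset\Omega$ is the subset of tilings having a tile with puncture at $0$. For a patch $p$, $\Xi(p)=\{T'\in\Xi: p\subset T'\}$. The equivalence relation of the transversal is $R_\Xi=\{(T,T')\in\Xi\times\Xi:\exists a\in\mathbb R^d,\ T'=T+a\}$, with topology: $(T_n,T_n+a_n)\to(T,T+a)$ iff $T_n\to T$ in $\Omega$ and $a_n\to a$ in $\mathbb R^d$. **Proper nested sequences.** A nested sequence of tilings is a sequence $(T_n)_{n\ge1}$ of tilings such that for all $n\ge2$ the tiles of $T_n$ are (supports of) patches of $T_{n-1}$; one assumes (without loss of generality) that $T_1$ has a tile with puncture at $0$. The substitution map $\sigma_n$ ($n\ge2$) sends each tile of $T_n$ to the patch of $T_{n-1}$ of which it is the support (tiles of $T_n$ with the same shape but corresponding to different patches are labelled as different); it is extended to translates of tiles by $\sigma_n(t+a)=\sigma_n(t)+a$ and to patches by unions; $\sigma_1$ is the identity. Let $r_n>0$ be the minimum of the inner radii and $R_n$ the maximum of the outer radii of the tiles of $T_n$. The sequence is proper if every $T_n$ is aperiodic, repetitive and has FLC, and for all $n\ge2$: (i) for each tile $t_n\in T_n$, $\sigma_n(t_n)$ is a patch of $T_{n-1}$; (ii) for each tile $t_n\in T_n$, $\sigma_n(t_n)$ contains a tile of $T_{n-1}$ in the interior of its support; (iii) there is $\rho>0$ independent of $n$ with $r_n>r_{n-1}+\rho$ and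 $R_n>R_{n-1}+\rho$. **Collars.** For $t\in T_n$, $\mathrm{Col}(t)=\{t'\in T_n:\mathrm{dist}(t,t')\le r_n\}$. A collared prototile of $T_n$ is a class of tiles of $T_n$ that agree, together with their collars, up to translation. There are finitely many; let $t^{(n)}_i$, $i=1,\dots,p_n$, denote their representatives with puncture at $0$ (a collared tile remembers its collar). **Bratteli diagram $\mathcal B=(\mathcal V,\mathcal E,r,s,u)$ of $(T_n)$.** $\mathcal V_0=\{\circ\}$, $\mathcal V_n=\{t^{(n)}_i\}_i$ for $n\ge1$; $\mathcal E_1$ has one edge from $\circ$ to each vertex of $\mathcal V_1$, with label $u=0$; for $n\ge2$, $\mathcal E_n$ has one edge $e$ with $s(e)=t^{(n-1)}_i$, $r(e)=t^{(n)}_j$ for each $a\in\mathbb R^d$ such that the collared tile $t^{(n-1)}_i+a$ is a tile of the patch $\sigma_n(t^{(n)}_j)$, and its label is $u(e)=-a$. $\Pi_n$ is the set of paths $\gamma=(e_1,\dots,e_n)$ with $e_i\in\mathcal E_i$, $r(e_i)=s(e_{i+1})$; $r(\gamma)=r(e_n)$ and $u(\gamma)=\sum_i u(e_i)$. $\partial\mathcal B$ is the set of infinite paths, with the topology inherited from the product of the discrete sets $\mathcal E_n$; $x|_{\Pi_n}$ is the prefix of length $n$ of $x$. For $\gamma\in\Pi_n$ with $r(\gamma)=t$, $p^c_\gamma=\sigma_1\circ\cdots\circ\sigma_n(\mathrm{Col}(t))+u(\gamma)$. The canonical homeomorphism $\varphi:\partial\mathcal B\to\Xi$ sends $x$ to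 the unique element of $\bigcap_n\Xi(p^c_{x|_{\Pi_n}})$. Write $T_x=\varphi(x)$. **Horizontal structure.** $\mathcal H=\bigsqcup_n\mathcal H_n$, $r,s:\mathcal H_n\to\mathcal V_n$: there is an edge $h\in\mathcal H_n$ with $s(h)=t$, $r(h)=t'$ and label $u(h)=a'-a$ whenever there are $a,a'\in\mathbb R^d$ such that the collared tiles $t+a$, $t'+a'$ belong to $T_n$, with $t+a\in\mathrm{Col}(t'+a')$ and $t'+a'\in\mathrm{Col}(t+a)$ (one edge for each triple $(t,t',a'-a)$; trivial edges $t=t'$, $u=0$ allowed). **The relation $R_{\mathcal B}$.** For $e,e'\in\mathcal E_n$, $h\in\mathcal H_{n-1}$, $h'\in\mathcal H_n$, one says $(h,e,e',h')$ is a commutative diagram if $s(h)=s(e)$, $r(h)=s(e')$, $r(e)=s(h')$, $r(e')=r(h')$ and $u(e)+u(h')=u(h)+u(e')$. For $x=(e_n)$, $y=(e'_n)$ in $\partial\mathcal B$, $x\sim y$ means: there are $n_0$ and $h_n\in\mathcal H_n$ for all $n\ge n_0$ such that $(h_{n-1},e_n,e'_n,h_n)$ is a commutative diagram for each $n>n_0$. $R_{\mathcal B}=\{(x,y)\in\partial\mathcal B\times\partial\mathcal B:x\sim y\}$. If $x\sim y$ there is a (unique) vector $a(x,y)\in\mathbb R^d$ with $T_y=T_x+a(x,y)$. Topology of $R_{\mathcal B}$: $(x_n,y_n)\to(x,y)$ iff $x_n\to x$ in $\partial\mathcal B$ and $a(x_n,y_n)\to a(x,y)$ in $\mathbb R^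d$.
   Formalization: The formal theorem assumes that the canonical map φ is injective (recognizability); this does not follow from the listed conditions on a proper nested sequence and is necessary for the claim; the rest of φ being a homeomorphism is proved. *)

(* Defs.v *)
From HB Require Import structures.
From mathcomp Require Import all_boot all_order all_algebra.
From mathcomp Require Import all_classical all_reals all_analysis.

Set Implicit Arguments.
Unset Strict Implicit.
Unset Printing Implicit Defensive.

Import Order.TTheory GRing.Theory Num.Theory.
Import numFieldNormedType.Exports.

Local Open Scope classical_set_scope.
Local Open Scope ring_scope.

Section Euclidean.
Variables (R : realType) (d : nat).
Implicit Types (x y : 'rV[R]_d) (A B : set 'rV[R]_d) (r : R).

(* The library norm on ['rV[R]_d] is the sup norm; balls, radii and distances
   of tiles are Euclidean.  Both norms define the same topology. *)
Definition enorm x : R := Num.sqrt (\sum_(i < d) x ord0 i ^+ 2).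
Definition eball x r : set 'rV[R]_d := [set y | enorm (y - x) < r].
Definition ecball x r : set 'rV[R]_d := [set y | enorm (y - x) <= r].
Definition edist A B : R := inf [set enorm (z.1 - z.2) | z in A `*` B].

Definition inner_radius x A : R := sup [set r | 0 <= r /\ ecball x r `<=` A].
Definition outer_radius x A : R := inf [set r | 0 <= r /\ A `<=` ecball x r].

End Euclidean.

Section CW.
Variables (R : realType) (d : nat).

Record cell := Cell { cell_dim : nat; cell_map : 'rV[R]_cell_dim -> 'rV[R]_d }.
Arguments cell_map : clear implicits.

Record cells := Cells { ncells : nat; cell_of :> 'I_ncells -> cell }.

Definition open_cell (c : cell) : set 'rV[R]_d := cell_map c @` eball 0 1.
Definition closed_cell (c : cell) : set 'rV[R]_d := cell_map c @` ecball 0 1.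

(* In a Hausdorff space, a finite family with these properties is a finite CW
   structure: the characteristic maps are then automatically homeomorphisms of
   the open balls onto the open cells. *)
Record finite_CW (K : cells) (X : set 'rV[R]_d) : Prop := FiniteCW {
  cw_cont : forall i, {within ecball 0 1, continuous (cell_map (K i))};
  cw_inj : forall i x y, eball 0 1 x -> eball 0 1 y ->
    cell_map (K i) x = cell_map (K i) y -> x = y;
  cw_disj : forall i j, i != j -> open_cell (K i) `&` open_cell (K j) = set0;
  cw_cover : \bigcup_i open_cell (K i) = X;
  cw_bdry : forall i x, enorm x = 1 -> exists j,
    (cell_dim (K j) < cell_dim (K i))%N /\ open_cell (K j) (cell_map (K i) x) }.

Definition subcomplex (K : cells) (A : set 'rV[R]_d) : Prop :=
  exists J : set 'I_(ncells K), \bigcup_(i in J) open_cell (K i) = A /\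
    forall i, J i -> closed_cell (K i) `<=` A.

End CW.

Section Tilings.
Variables (R : realType) (d : nat) (L : Type).
Local Notation Rd := 'rV[R]_d.

Record tile := Tile { supp : set Rd; punct : Rd; label : L }.

Definition is_tile (t : tile) : Prop :=
  [/\ compact (supp t), closure (supp t)° = supp t & supp t (punct t)].

Definition tshift (t : tile) (a : Rd) : tile :=
  Tile [set x + a | x in supp t] (punct t + a) (label t).
Definition pshift (p : set tile) (a : Rd) : set tile :=
  [set tshift t a | t in p].

Definition psupport (p : set tile) : set Rd := \bigcup_(t in p) supp t.

Definition disjoint_interiors (p : set tile) : Prop :=
  forall t t', p t -> p t' -> t <> t' -> (supp t)° `&` (supp t')° = set0.

Definition is_tiling (S : set tile) : Prop :=
  [/\ countable S, S `<=` is_tile, disjoint_interiors S & psupport S = setT].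

Record tiling := Tiling { tiles :> set tile; tilingP : is_tiling tiles }.

HB.instance Definition _ := gen_eqMixin tiling.
HB.instance Definition _ := gen_choiceMixin tiling.

Definition cellular (S : set tile) : Prop := exists K : tile -> cells R d,
  (forall t, S t -> finite_CW (K t) (supp t)) /\
  (forall t t', S t -> S t' -> subcomplex (K t) (supp t `&` supp t') /\
                               subcomplex (K t') (supp t `&` supp t')).

Definition patch_of (S p : set tile) : Prop := finite_set p /\ p `<=` S.

(* A patch is punctured by the puncture of one of its tiles; any choice is
   admitted. *)
Definition FLC (S : set tile) : Prop := forall r : R, 0 < r ->
  exists F : set (set tile), finite_set F /\
    forall p t, patch_of S p -> p t ->
      outer_radius (punct t) (psupport p) < r ->
      exists q a, F q /\ p = pshift q a.

Definition repetitive (S : set tile) : Prop := forall p, patch_of S p ->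
  exists2 r : R, 0 < r & forall x : Rd, exists a : Rd,
    pshift p a `<=` S /\ psupport (pshift p a) `<=` eball x r.

Definition aperiodic (S : set tile) : Prop :=
  forall a : Rd, a != 0 -> pshift S a <> S.

Definition min_inner_radius (S : set tile) : R :=
  inf [set inner_radius (punct t) (supp t) | t in S].
Definition max_outer_radius (S : set tile) : R :=
  sup [set outer_radius (punct t) (supp t) | t in S].

Definition agree_eps (S S' : set tile) : set R := [set e | 0 < e < 1 /\
  exists a a' : Rd, [/\ eball 0 e a, eball 0 e a' &
    forall t, eball 0 e^-1 (punct t) -> (pshift S a t <-> pshift S' a' t)]].

(* [min (inf A) 1] with the convention [inf set0 = +oo] (the library's real
   [inf set0] is [0]), for [A] contained in the interval ]0, 1[. *)
Definition delta (S S' : set tile) : R := inf (agree_eps S S' `|` [set 1]).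

Definition delta_open (U : set tiling) : Prop := forall S, U S ->
  exists2 e : R, 0 < e & forall S' : tiling, delta S S' < e -> U S'.

Lemma delta_openT : delta_open setT.
Proof. by move=> S _; exists 1. Qed.

Lemma delta_openI : setI_closed delta_open.
Proof.
move=> U V Uo Vo S [/Uo[e e0 eU] /Vo[f f0 fV]].
exists (Num.min e f); first by rewrite lt_min e0 f0.
by move=> S'; rewrite lt_min => /andP[/eU ? /fV ?]; split.
Qed.

Lemma delta_open_bigU (I : Type) (U : I -> set tiling) :
  (forall i, delta_open (U i)) -> delta_open (\bigcup_i U i).
Proof.
move=> Uo S [i _ /Uo[e e0 eU]]; exists e => // S' /eU ?.
by exists i.
Qed.

HB.instance Definition _ := isOpenTopological.Build tiling
  delta_openT delta_openI delta_open_bigU.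

Definition hull (S : tiling) : set tiling :=
  closure [set S' : tiling | exists a, tiles S' = pshift S a].

Definition transversal (S : tiling) : set tiling :=
  hull S `&` [set S' : tiling | exists2 t, tiles S' t & punct t = 0].

(* The vector [a] with [S' = S + a], for translates of an aperiodic tiling. *)
Definition trans_vec (S S' : tiling) : Rd :=
  xget 0 [set a | tiles S' = pshift S a].

Definition R_transversal (S : tiling) :
    set (set_type (transversal S) * set_type (transversal S)) :=
  [set z | exists a, tiles (set_val z.2) = pshift (tiles (set_val z.1)) a].

Arguments R_transversal : clear implicits.

(* Convergence of [(S, S + a)] is convergence of [S] and of [a]; this is not
   the topology induced by the product. *)
Definition R_transversal_space (S : tiling) : topologicalType :=
  initial_topology (fun z : set_type (R_transversal S) =>
    ((set_val z).1,
     trans_vec (set_val (set_val z).1) (set_val (set_val z).2))).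

End Tilings.

Section NestedSequences.
Variables (R : realType) (d : nat) (L : Type).
Local Notation Rd := 'rV[R]_d.
Local Notation tile := (tile R d L).
Local Notation tiling := (tiling R d L).

(* Sequences are indexed from 1: the value at 0 is never used. *)
Variable T : nat -> tiling.

Definition subtiles n (t : tile) : set tile :=
  [set s | tiles (T n.-1) s /\ supp s `<=` supp t].

Record nested_sequence : Prop := NestedSequence {
  ns_cellular : forall n, (1 <= n)%N -> cellular (T n);
  ns_patch : forall n t, (2 <= n)%N -> tiles (T n) t ->
    exists2 p, patch_of (T n.-1) p & psupport p = supp t;
  (* tiles equal up to translation, label included, correspond to patches equal
     up to the same translation *)
  ns_label : forall n t a, (2 <= n)%N ->
    tiles (T n) t -> tiles (T n) (tshift t a) ->
    subtiles n (tshift t a) = pshift (subtiles n t) a;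
  ns_origin : exists2 t, tiles (T 1%N) t & punct t = 0 }.

(* [sigma n] on a translate [t] of a tile [tshift t b] of [T n]; by [ns_label]
   the result does not depend on [b]. *)
Definition sigma n (t : tile) : set tile :=
  if (n <= 1)%N then [set t] else
  [set s | exists b, tiles (T n) (tshift t b) /\
                     subtiles n (tshift t b) (tshift s b)].

Definition sigma_patch n (p : set tile) : set tile :=
  \bigcup_(t in p) sigma n t.

(* [sigma_1 \o ... \o sigma_n] *)
Fixpoint sigma_comp n (p : set tile) : set tile :=
  if n is m.+1 then sigma_comp m (sigma_patch n p) else p.

Local Notation r n := (min_inner_radius (T n)).
Local Notation R_ n := (max_outer_radius (T n)).

Record proper_sequence : Prop := ProperSequence {
  pr_aperiodic : forall n, (1 <= n)%N -> aperiodic (T n);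
  pr_repetitive : forall n, (1 <= n)%N -> repetitive (T n);
  pr_FLC : forall n, (1 <= n)%N -> FLC (T n);
  pr_inner : forall n, (1 <= n)%N -> 0 < r n;
  pr_outer : forall n, (1 <= n)%N ->
    has_ubound [set outer_radius (punct t) (supp t) | t in tiles (T n)];
  pr_patch : forall n t, (2 <= n)%N -> tiles (T n) t ->
    patch_of (T n.-1) (sigma n t);
  pr_interior : forall n t, (2 <= n)%N -> tiles (T n) t ->
    exists2 s, sigma n t s & supp s `<=` (psupport (sigma n t))°;
  pr_growth : exists2 rho : R, 0 < rho & forall n, (2 <= n)%N ->
    r n > r n.-1 + rho /\ R_ n > R_ n.-1 + rho }.

Definition collar n (t : tile) : set tile :=
  [set t' | tiles (T n) t' /\ edist (supp t) (supp t') <= r n].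

Definition ctile : Type := (tile * set tile)%type.
Definition cshift (c : ctile) (a : Rd) : ctile :=
  (tshift c.1 a, pshift c.2 a).

Definition ctile_in n (c : ctile) : Prop :=
  tiles (T n) c.1 /\ c.2 = collar n c.1.

Definition collared_prototiles n : set ctile :=
  [set c | punct c.1 = 0 /\ exists a, ctile_in n (cshift c a)].

(* [None] is the root of the diagram. *)
Definition vertex : Type := option ctile.

Definition vertices n : set vertex :=
  if n is 0 then [set None] else Some @` collared_prototiles n.

Record edge := Edge { esrc : vertex; erng : vertex; elab : Rd }.

HB.instance Definition _ := gen_eqMixin edge.
HB.instance Definition _ := gen_choiceMixin edge.

(* There is at most one edge with given source, range and label, so an edge is
   identified with this triple.  The set of edges of level 0 is empty. *)
Definition edges n : set edge :=
  match n with
  | 0 => set0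
  | 1 => [set Edge None v 0 | v in vertices 1]
  | _ => [set e | exists (c c' : ctile) (a b : Rd),
      [/\ e = Edge (Some c) (Some c') (- a),
          collared_prototiles n.-1 c /\ collared_prototiles n c',
          sigma n c'.1 (tshift c.1 a),
          ctile_in n (cshift c' b) & ctile_in n.-1 (cshift c (a + b))]]
  end.

(* The path [(e_1, e_2, ...)] is the sequence [x] with [x k = e_{k+1}]. *)
Definition infinite_paths : set {ptws nat -> discrete_topology edge} :=
  [set x | forall k, edges k.+1 (x k) /\ erng (x k) = esrc (x k.+1)].

Local Notation dB := (set_type infinite_paths).

Definition path_prefix (x : dB) n : seq edge := mkseq (set_val x) n.
Definition path_range (g : seq edge) : vertex := last None (map erng g).
Definition path_label (g : seq edge) : Rd := \sum_(e <- g) elab e.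

Definition path_patch (g : seq edge) : set tile :=
  if path_range g is Some c
  then pshift (sigma_comp (size g) c.2) (path_label g) else set0.

(* [phi x] is the element of the transversal of [T 1] containing the patches of
   all finite prefixes of [x]; the default value [T 1] is irrelevant for a
   proper nested sequence.  Injectivity of [phi] expresses that a tiling in the
   transversal determines its decompositions into tiles of all levels
   (recognizability); it is not a consequence of [proper_sequence]: the unit
   intervals of a Sturmian sequence may be grouped into tiles of [T 2] along a
   rationally independent second Sturmian sequence. *)
Definition phi (x : dB) : tiling :=
  xget (T 1%N) [set S | transversal (T 1%N) S /\
    forall n, (1 <= n)%N -> path_patch (path_prefix x n) `<=` S].

Definition hedges n : set edge :=
  [set h | exists (c c' : ctile) (a a' : Rd),
    [/\ h = Edge (Some c) (Some c') (a' - a),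
        collared_prototiles n c /\ collared_prototiles n c',
        ctile_in n (cshift c a) /\ ctile_in n (cshift c' a'),
        (cshift c' a').2 (cshift c a).1 & (cshift c a).2 (cshift c' a').1]].

Definition commutative_diagram (h e e' h' : edge) : Prop :=
  [/\ esrc h = esrc e, erng h = esrc e', erng e = esrc h', erng e' = erng h' &
      elab e + elab h' = elab h + elab e'].

Definition path_equiv (x y : dB) : Prop :=
  exists (n0 : nat) (h : nat -> edge), (1 <= n0)%N /\
    (forall n, (n0 <= n)%N -> hedges n (h n)) /\
    (forall n, (n0 < n)%N ->
       commutative_diagram (h n.-1) (set_val x n.-1) (set_val y n.-1) (h n)).

Definition R_diagram : set (dB * dB) := [set z | path_equiv z.1 z.2].

Definition R_diagram_space : topologicalType :=
  initial_topology (fun z : set_type R_diagram =>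
    ((set_val z).1, trans_vec (phi (set_val z).1) (phi (set_val z).2))).

End NestedSequences.

Definition homeomorphism (X Y : topologicalType) (f : X -> Y) : Prop :=
  continuous f /\
  exists g : Y -> X, [/\ continuous g, cancel f g & cancel g f].

(* Main.v *)
(** A path of the diagram amounts to a chain of collared tiles
    [C_0, C_1, ...] placed in space, each a tile of the next one, starting with
    a tile punctured at 0.  The collar of [C_k] covers the ball of radius
    [r_(k+1)] around 0, so a chain determines tilings of all levels (a "tower"),
    the lowest of which is [phi x]; conversely every tile at 0 in a tower starts
    a chain.

    If [x ~ y], the labels make [u(x|n) + u(h_n) - u(y|n)] constant, and the
    collars at level [n] of both paths share a patch covering a ball whose
    radius tends to infinity, so [phi x] and [phi y] are translates.
    Conversely, if [phi y = phi x + a], let [X] be a tower with [X_0 = phi x].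
    The chain of [X + a] at the origin yields a path with image [phi y], which
    is [y] because [phi] is injective, and likewise [X] yields [x]; at levels
    with [r_n > |a|] the tiles of both chains lie in each other's collars, which
    gives the horizontal edges.

    Since finite local complexity makes the edge sets finite, the path space is
    compact, and [phi] is a continuous bijection onto the Hausdorff transversal,
    hence a homeomorphism.  Both topologies on the relations are pulled back
    from a point and a translation vector, and [phi] preserves the latter. *)

Require Import Defs.
From mathcomp Require Import all_boot all_order all_algebra.
From mathcomp Require Import all_classical all_reals all_analysis.
From mathcomp Require Import ring lra.

Set Implicit Arguments.
Unset Strict Implicit.
Unset Printing Implicit Defensive.

Import Order.TTheory GRing.Theory Num.Theory.
Import numFieldNormedType.Exports.

Local Open Scope classical_set_scope.
Local Open Scope ring_scope.

(* These names are shadowed by the libraries loaded after [Defs]. *)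
Local Notation edist := Defs.edist.
Local Notation transversal := Defs.transversal.

(** * Euclidean norm *)

Section EuclideanNorm.
Variables (R : realType) (d : nat).
Implicit Types (x y : 'rV[R]_d) (A : set 'rV[R]_d).

Lemma enorm_ge0 x : 0 <= enorm x.
Proof. exact: sqrtr_ge0. Qed.

Lemma enorm0 : enorm (0 : 'rV[R]_d) = 0.
Proof. by rewrite /enorm big1 ?sqrtr0// => i _; rewrite mxE expr0n. Qed.

Lemma enormN x : enorm (- x) = enorm x.
Proof. by congr (Num.sqrt _); apply: eq_bigr => i _; rewrite mxE sqrrN. Qed.

Lemma enorm_sqr x : enorm x ^+ 2 = \sum_(i < d) x ord0 i ^+ 2.
Proof. by rewrite sqr_sqrtr// sumr_ge0// => i _; exact: sqr_ge0. Qed.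

Lemma enorm_eq0 x : enorm x = 0 -> x = 0.
Proof.
move=> x0; have /eqP := enorm_sqr x; rewrite x0 expr0n /= eq_sym.
rewrite psumr_eq0 => [/allP x0'|i _]; last exact: sqr_ge0.
apply/rowP => i; rewrite mxE; apply/eqP.
by have := x0' i (mem_index_enum _); rewrite /= sqrf_eq0.
Qed.

(** The squares of $|y|x_i-|x|y_i$ sum to $2|x||y|(|x||y|-\langle x,y\rangle)$. *)
Lemma cauchy_schwarz x y :
  \sum_(i < d) x ord0 i * y ord0 i <= enorm x * enorm y.
Proof.
have [x0|xn0] := eqVneq (enorm x) 0.
  by rewrite x0 mul0r (enorm_eq0 x0) big1// => i _; rewrite mxE mul0r.
have [y0|yn0] := eqVneq (enorm y) 0.
  by rewrite y0 mulr0 (enorm_eq0 y0) big1// => i _; rewrite mxE mulr0.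
have xy0 : 0 < enorm x * enorm y.
  by rewrite mulr_gt0// lt_def ?xn0 ?yn0 enorm_ge0.
have : 0 <= \sum_(i < d) (enorm y * x ord0 i - enorm x * y ord0 i) ^+ 2.
  by apply: sumr_ge0 => i _; exact: sqr_ge0.
rewrite (eq_bigr (fun i => enorm y ^+ 2 * x ord0 i ^+ 2
   + enorm x ^+ 2 * y ord0 i ^+ 2
   + (- (2 * (enorm x * enorm y))) * (x ord0 i * y ord0 i))); last first.
  by move=> i _; lra.
rewrite !big_split/= -!mulr_sumr -!enorm_sqr.
set s := \sum_(i < d) _.
rewrite (_ : _ + _ = 2 * (enorm x * enorm y) * (enorm x * enorm y - s)); last first.
  by lra.
by rewrite pmulr_rge0 ?subr_ge0// mulr_gt0.
Qed.

Lemma enormD x y : enorm (x + y) <= enorm x + enorm y.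
Proof.
rewrite -(@ler_pXn2r _ 2) ?nnegrE ?addr_ge0 ?enorm_ge0//.
rewrite enorm_sqr sqrrD !enorm_sqr.
rewrite (eq_bigr (fun i => x ord0 i ^+ 2 + y ord0 i ^+ 2
   + 2 * (x ord0 i * y ord0 i))); last by move=> i _; rewrite mxE; lra.
rewrite !big_split/= -mulr_sumr; have := cauchy_schwarz x y; lra.
Qed.

Lemma enormB x y : enorm (x - y) = enorm (y - x).
Proof. by rewrite -enormN opprB. Qed.

Lemma enorm_continuous : continuous (@enorm R d).
Proof.
move=> x; apply: continuous_comp; last exact: sqrt_continuous.
have -> : (fun x : 'rV[R]_d => \sum_(i < d) x ord0 i ^+ 2) =
    \sum_(i < d) (fun x : 'rV[R]_d => x ord0 i ^+ 2).
  by apply/funext => z; rewrite fct_sumE.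
elim/big_ind: _ => [|f g fc gc|i _].
- exact: cst_continuous.
- exact: continuousD.
- apply: (@continuous_comp _ _ _ (fun M : 'rV[R]_d => M ord0 i) (fun r => r ^+ 2)).
    exact: coord_continuous.
  exact: exprn_continuous.
Qed.

Lemma eball_open x r : open (eball x r).
Proof.
rewrite (_ : eball x r = (fun y => enorm (y - x)) @^-1` [set s | s < r])//.
apply: open_comp; last exact: open_lt.
move=> y _; apply: continuous_comp; last exact: enorm_continuous.
apply: continuousB; [exact: cvg_id|exact: cst_continuous].
Qed.

Lemma compact_ecball A : compact A -> exists2 r, 0 <= r & A `<=` ecball 0 r.
Proof.
move=> cA; have : compact (@enorm R d @` A).
  apply: continuous_compact => //.
  by apply: continuous_subspaceT => x; exact: enorm_continuous.
move=> /(@compact_bounded R R^o)[M [_ AM]].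
exists (Num.max 0 (M + 1)); first by rewrite le_max lexx.
move=> x Ax; rewrite /ecball/= subr0 le_max; apply/orP; right.
have := AM (M + 1) _ (enorm x) (ex_intro2 _ _ x Ax erefl).
by rewrite /= ger0_norm ?enorm_ge0//; apply; rewrite ltrDl.
Qed.

(** * Topology and translations *)

Lemma nbhs_shift (a x : 'rV[R]_d) A :
  nbhs (x + a) A <-> nbhs x [set y | A (y + a)].
Proof.
have shc b : continuous (fun y : 'rV[R]_d => y + b).
  by move=> y; apply: continuousD; [exact: cvg_id|exact: cst_continuous].
split=> [nA|nA]; first exact: (shc a x A nA).
have := shc (- a) (x + a) [set y | A (y + a)]; rewrite addrK => /(_ nA).
move=> nA'; apply: (@filterS _ (nbhs (x + a)) _ _ _ _ nA') => y /=.
by rewrite subrK.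
Qed.

Lemma image_shiftE A (a : 'rV[R]_d) : [set x + a | x in A] = [set y | A (y - a)].
Proof.
apply/seteqP; split => y /=; first by case=> x Ax <-; rewrite addrK.
by move=> Ay; exists (y - a); rewrite ?subrK.
Qed.

Lemma interior_shift A (a : 'rV[R]_d) :
  [set y | A (y - a)]° = [set y | A° (y - a)].
Proof.
apply/seteqP; split => y; rewrite /interior /=.
  by rewrite -{1}(subrK a y) => /nbhs_shift; apply: filterS => z /=; rewrite addrK.
move=> nA; rewrite -(subrK a y); apply/nbhs_shift.
by apply: filterS nA => z /=; rewrite addrK.
Qed.

Lemma closure_shift A (a : 'rV[R]_d) :
  closure [set y | A (y - a)] = [set y | closure A (y - a)].
Proof.
apply/seteqP; split => y /= cA B nB.
- have [|z [Az Bz]] := cA [set z | B (z - a)].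
    rewrite -(subrK a y); apply/nbhs_shift.
    by apply: filterS nB => z /=; rewrite addrK.
  by exists (z - a).
- have [|z [Az Bz]] := cA [set z | B (z + a)].
    by apply: (nbhs_shift a (y - a) B).1; rewrite subrK.
  by exists (z + a); split => //=; rewrite addrK.
Qed.

End EuclideanNorm.

(** * Tiles and tilings *)

Section Tiles.
Variables (R : realType) (d : nat) (L : Type).
Implicit Types (S p : set (tile R d L)) (s t : tile R d L) (a : 'rV[R]_d).

Lemma supp_tshift t a : supp (tshift t a) = [set y | supp t (y - a)].
Proof. exact: image_shiftE. Qed.

Lemma supp_tshiftE t a z : supp (tshift t a) z = supp t (z - a).
Proof. by rewrite supp_tshift. Qed.

Lemma tshiftD t a b : tshift (tshift t a) b = tshift t (a + b).
Proof.
rewrite /tshift/= addrA; congr Tile; rewrite !image_shiftE.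
by apply/seteqP; split => z /=; rewrite opprD addrA addrAC.
Qed.

Lemma tshift0 t : tshift t 0 = t.
Proof.
case: t => A x l; rewrite /tshift/= addr0; congr Tile.
by rewrite image_shiftE; apply/seteqP; split => z /=; rewrite subr0.
Qed.

Lemma tshiftK t a : tshift (tshift t a) (- a) = t.
Proof. by rewrite tshiftD subrr tshift0. Qed.

Lemma tshiftNK t a : tshift (tshift t (- a)) a = t.
Proof. by rewrite tshiftD addNr tshift0. Qed.

Lemma pshiftE p a t : pshift p a t <-> p (tshift t (- a)).
Proof.
split=> [[s ps <-]|pt]; first by rewrite tshiftK.
by exists (tshift t (- a)); rewrite ?tshiftNK.
Qed.

Lemma pshift_tshift p a t : pshift p a (tshift t a) <-> p t.
Proof. by rewrite pshiftE tshiftK. Qed.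

Lemma pshiftD p a b : pshift (pshift p a) b = pshift p (a + b).
Proof.
apply/seteqP; split => t; rewrite !pshiftE tshiftD opprD //.
  by rewrite addrC.
by rewrite addrC.
Qed.

Lemma pshift0 p : pshift p 0 = p.
Proof. by apply/seteqP; split => t; rewrite pshiftE oppr0 tshift0. Qed.

Lemma pshiftK p a : pshift (pshift p a) (- a) = p.
Proof. by rewrite pshiftD subrr pshift0. Qed.

Lemma pshiftNK p a : pshift (pshift p (- a)) a = p.
Proof. by rewrite pshiftD addNr pshift0. Qed.

Lemma pshiftS p q a : p `<=` q -> pshift p a `<=` pshift q a.
Proof. exact: image_subset. Qed.

Lemma psupport_pshift p a z : psupport (pshift p a) z <-> psupport p (z - a).
Proof.
split=> [[t /pshiftE pt tz]|[t pt tz]].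
  by exists (tshift t (- a)); rewrite // supp_tshiftE opprK subrK.
by exists (tshift t a); [exact/pshift_tshift|rewrite supp_tshiftE].
Qed.

Lemma is_tile_shift t a : is_tile t -> is_tile (tshift t a).
Proof.
case=> tc tcl tp; split.
- apply: continuous_compact => //; apply: continuous_subspaceT => x.
  by apply: continuousD; [exact: cvg_id|exact: cst_continuous].
- by rewrite supp_tshift interior_shift closure_shift tcl.
- by rewrite supp_tshiftE/= addrK.
Qed.

Lemma is_tile_shiftE t a : is_tile (tshift t a) <-> is_tile t.
Proof.
split; last exact: is_tile_shift.
by move=> /(is_tile_shift (- a)); rewrite tshiftK.
Qed.

(** A tile is the closure of its interior. *)
Lemma tile_interior_meet t (U : set 'rV[R]_d) : is_tile t -> open U ->
  supp t `&` U !=set0 -> (supp t)° `&` U !=set0.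
Proof.
move=> [_ tcl _] oU [z [tz Uz]].
have : closure (supp t)° z by rewrite tcl.
by apply; exact: open_nbhs_nbhs.
Qed.

Lemma tiling_overlap S s t : is_tiling S -> S s -> S t ->
  supp s `&` (supp t)° !=set0 -> s = t.
Proof.
move=> [_ Sti Sd _] Ss St st; apply: contrapT => nst.
have [z] := tile_interior_meet (Sti _ Ss) (@open_interior _ _) st.
by rewrite (Sd _ _ Ss St nst).
Qed.

(** The interior of [t] meets [U] in a point of some tile of [p], and overlapping tiles of [S]
    coincide. Local agreement of tilings rests on this. *)
Lemma cover_mem S p t (U : set 'rV[R]_d) : is_tiling S -> p `<=` S -> S t ->
  open U -> U `<=` psupport p -> supp t `&` U !=set0 -> p t.
Proof.
move=> Stil pS St oU Up; have [_ Sti _ _] := Stil.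
move=> /(tile_interior_meet (Sti _ St) oU)[z [tz /Up[s ps sz]]].
by rewrite -(@tiling_overlap S s t) //; [exact: pS|exists z].
Qed.

Lemma is_tiling_shift S a : is_tiling S -> is_tiling (pshift S a).
Proof.
move=> [Sc Sti Sd Scov]; split.
- exact: sub_countable (card_image_le _ _) Sc.
- by move=> t [s /Sti st <-]; exact: is_tile_shift.
- move=> _ _ [s Ss <-] [t St <-] nst; rewrite !supp_tshift !interior_shift.
  apply/seteqP; split => // z /= [sz tz].
  have : ((supp s)° `&` (supp t)°) (z - a) by [].
  by rewrite (Sd _ _ Ss St) // => st; apply: nst; rewrite st.
- apply/seteqP; split => // z _; apply/psupport_pshift.
  by rewrite Scov.
Qed.

(** The puncture of a tile of [S] lies in a ball covered by a common patch, which then contains the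
    tile. *)
Lemma tiling_subset S S' :
  is_tiling S -> (forall M, exists p, [/\ p `<=` S, p `<=` S' &
    eball 0 M `<=` psupport p]) -> S `<=` S'.
Proof.
move=> Stil cov t St; have [_ Sti _ _] := Stil; have [_ _ tp] := Sti _ St.
have [p [pS pS' Mp]] := cov (enorm (punct t) + 1).
apply: pS'; apply: (cover_mem Stil pS St _ Mp); first exact: eball_open.
by exists (punct t); split=> //; rewrite /eball/= subr0 ltrDl.
Qed.

Lemma tiling_eq (S S' : tiling R d L) : tiles S = tiles S' -> S = S'.
Proof.
case: S S' => [S SP] [S' SP']/= SS'; subst S'.
by rewrite (Prop_irrelevance SP SP').
Qed.

(** Tilings are compared on tiles that meet a ball, not on tiles punctured in it, because this
    condition passes from a tile to its parent with the same [M]. *)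
Definition hits t (M : R) := exists2 z, supp t z & enorm z < M.

Lemma hits_eball t M : hits t M -> supp t `&` eball 0 M !=set0.
Proof. by case=> z tz zM; exists z; rewrite /eball/= subr0. Qed.

Lemma tile_bounded t : is_tile t -> exists M, forall z, supp t z -> enorm z < M.
Proof.
move=> [/compact_ecball[r r0 tr] _ _]; exists (r + 1) => z /tr.
by rewrite /ecball/= subr0 => zr; rewrite (le_lt_trans zr)// ltrDl.
Qed.

(** * Distances between tiles *)

Lemma edist_le (A B : set 'rV[R]_d) z z' :
  A z -> B z' -> edist A B <= enorm (z - z').
Proof.
move=> Az Bz; apply: ge_inf; last by exists (z, z').
by exists 0 => _ [y _ <-]; exact: enorm_ge0.
Qed.

(** Nonemptiness matters because the infimum of the empty set is 0. *)
Lemma edist_lt (A B : set 'rV[R]_d) r : A !=set0 -> B !=set0 -> edist A B < r ->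
  exists z z', [/\ A z, B z' & enorm (z - z') < r].
Proof.
move=> [x Ax] [y By] /inf_lt[|_ [[z z'] [Az Bz] <-] zr].
  by exists (enorm (x - y)); exists (x, y).
by exists z, z'.
Qed.

Lemma edistC (A B : set 'rV[R]_d) : edist A B = edist B A.
Proof.
congr inf; apply/seteqP; split => _ [[z z'] [/= Az Bz] <-];
  by exists (z', z) => //=; rewrite enormB.
Qed.

Lemma edist_shift s t a : edist (supp (tshift s a)) (supp (tshift t a)) =
  edist (supp s) (supp t).
Proof.
have aK (x y : 'rV[R]_d) : x + a - (y + a) = x - y.
  by rewrite opprD addrACA subrr addr0.
congr inf; apply/seteqP; split => [_ [_ [[x sx <-] [y ty <-]] <-]|].
  by exists (x, y); rewrite //= aK.
move=> _ [[x y] [sx ty] <-]; exists (x + a, y + a); last by rewrite /= aK.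
by split; [exists x|exists y].
Qed.

Lemma edist_subset (A A' B B' : set 'rV[R]_d) : A `<=` A' -> B `<=` B' ->
  A !=set0 -> B !=set0 -> edist A' B' <= edist A B.
Proof.
move=> AA' BB' [x Ax] [y By]; apply: lb_le_inf.
  by exists (enorm (x - y)); exists (x, y).
by move=> _ [[z z'] [/AA' Az /BB' Bz] <-]; exact: edist_le.
Qed.

End Tiles.

(** * Nested sequences *)

Section Nested.
Variables (R : realType) (d : nat) (L : Type) (T : nat -> tiling R d L).
Hypotheses (T_nested : nested_sequence T) (T_proper : proper_sequence T).
Local Notation tile := (tile R d L).
Local Notation r n := (min_inner_radius (T n)).
Implicit Types (s t : tile) (p q : set tile) (a b w z : 'rV[R]_d) (n k : nat).

Lemma T_tile n t : tiles (T n) t -> is_tile t.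
Proof. by case: (tilingP (T n)) => _ + _ _; apply. Qed.

Lemma r_gt0 n : 0 < r n.+1.
Proof. exact: pr_inner. Qed.

Lemma r_incr n : r n.+1 <= r n.+2.
Proof.
have [rho rho0 /(_ n.+2 isT)[/= grow _]] := pr_growth T_proper.
by apply: le_trans (ltW grow); rewrite lerDl ltW.
Qed.

Lemma r_homo : {homo (fun n => r n.+1) : m n / (m <= n)%N >-> m <= n}.
Proof. exact: (homo_leq lexx le_trans r_incr). Qed.

(** The growth condition yields $r_{n+1}>n\rho$ by induction. *)
Lemma r_unbounded M : exists n, M < r n.+1.
Proof.
have [rho rho0 grow] := pr_growth T_proper.
have lin n : n%:R * rho < r n.+1.
  elim: n => [|n IH]; first by rewrite mul0r r_gt0.
  have [/= + _] := grow n.+2 isT; apply: lt_trans.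
  by rewrite -natr1 mulrDl mul1r ltrD2r.
exists (Num.truncn (M / rho)).+1; apply: lt_trans (lin _).
by rewrite -ltr_pdivrMr// truncnS_gt.
Qed.

Lemma inner_ball n t z : tiles (T n) t -> enorm (z - punct t) < r n -> supp t z.
Proof.
(* Where no supremum exists [sup] is 0, so 0 bounds all inner radii from below and their infimum is
   a genuine lower bound. *)
move=> Tt; have sup0 s : 0 <= inner_radius (punct s) (supp s).
  rewrite /inner_radius; have [hs|/sup_out->//] := pselect (has_sup [set e | 0 <= e /\
    ecball (punct s) e `<=` supp s]).
  case: (hs) => -[e es] bound; have [e0 _] := es.
  by apply: (le_trans e0); exact: sup_ubound.
have : r n <= inner_radius (punct t) (supp t).
  apply: ge_inf; last by exists t.
  by exists 0 => _ [s _ <-].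
move=> /[swap] /lt_le_trans/[apply] zt.
have [|e [_ /(_ z)]] := @sup_gt _ _ _ _ zt; last by move=> et ze; apply/et/ltW.
(* Radius 0 is admissible: this closed ball is just the puncture. *)
exists 0; split => // y; rewrite /ecball/= => yt.
have [_ _] := T_tile Tt; rewrite (_ : y = punct t)//.
apply/eqP; rewrite -subr_eq0; apply/eqP/enorm_eq0/eqP.
by rewrite eq_le yt enorm_ge0.
Qed.

Lemma outer_ball n : exists2 M, 0 <= M & forall t, tiles (T n.+1) t ->
  forall z, supp t z -> enorm (z - punct t) <= M.
Proof.
have [B TB] := pr_outer T_proper (isT : 1 <= n.+1)%N.
exists (Num.max 0 (B + 1)); first by rewrite le_max lexx.
move=> t Tt z tz; rewrite le_max; apply/orP; right.
have : outer_radius (punct t) (supp t) < B + 1.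
  by rewrite (@le_lt_trans _ _ B) ?ltrDl//; apply: TB; exists t.
move=> /inf_lt[|e [e0 te] /ltW]; last by apply: le_trans; exact: te.
(* The set of admissible radii is nonempty: a tile in the closed ball of radius [e] around 0 lies in
   that of radius [e + e] around its puncture. *)
have [/compact_ecball[e e0 te] _ tt] := T_tile Tt.
exists (e + e); split; first exact: addr_ge0.
move=> y ty; rewrite /ecball/= (le_trans (enormD _ _))// enormN.
have := te _ ty; have := te _ tt; rewrite /ecball/= !subr0 => ? ?.
exact: lerD.
Qed.

Lemma tile_nonempty t : is_tile t -> supp t !=set0.
Proof. by case=> _ _ ?; exists (punct t). Qed.

Lemma edist_le_near n s t : is_tile s -> is_tile t ->
  edist (supp s) (supp t) <= r n ->
  exists z z', [/\ supp s z, supp t z' & enorm (z - z') < r n + 1].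
Proof.
move=> /tile_nonempty s0 /tile_nonempty t0 st; apply: edist_lt => //.
by rewrite (le_lt_trans st)// ltrDl.
Qed.

(** An interior point of [s] lies in some [t] of the next level. As [t] is the support of a patch, a
    tile of this patch contains the point, overlaps [s], and is therefore [s]. *)
Lemma parent_exists n s : tiles (T n.+1) s ->
  exists2 t, tiles (T n.+2) t & supp s `<=` supp t.
Proof.
move=> Ts; have sT := T_tile Ts.
have s0 : supp s `&` setT !=set0 by rewrite setIT; exact: tile_nonempty.
have [z [sz _]] := tile_interior_meet sT openT s0.
have [t Tt tz] : psupport (T n.+2) z.
  by have [_ _ _ ->] := tilingP (T n.+2).
exists t => //; have [p [_ pT] pt] := ns_patch T_nested (isT : 2 <= n.+2)%N Tt.
move: tz; rewrite -pt => -[s' ps' s'z].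
rewrite -(@tiling_overlap _ _ _ (T n.+1) s' s) //.
- by move=> y s'y; exists s'.
- exact: tilingP.
- exact: pT.
- by exists z.
Qed.

(** * The substitution maps *)

Lemma subtiles_tshift n t s a : tiles (T n.+2) t -> tiles (T n.+2) (tshift t a) ->
  tiles (T n.+1) s -> supp s `<=` supp t -> tiles (T n.+1) (tshift s a).
Proof.
move=> Tt Tta Ts st; have : pshift (subtiles T n.+2 t) a (tshift s a).
  by apply/pshift_tshift.
by rewrite -(ns_label T_nested)// => -[].
Qed.

(** By [ns_label], the patches of two translates of [t] differ by the same translation, so any
    admissible [b] computes [sigma]. *)
Lemma sigmaP n t s b : tiles (T n.+2) (tshift t b) ->
  sigma T n.+2 t s <-> tiles (T n.+1) (tshift s b) /\ supp s `<=` supp t.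
Proof.
move=> Tt; have sub c : supp (tshift s c) `<=` supp (tshift t c) <->
    supp s `<=` supp t.
  rewrite !supp_tshift; split=> st z /=; last exact: st.
  by have := st (z + c); rewrite /= addrK.
split=> [[c [Tc [Ts /sub st]]]|[Ts st]]; last first.
  by exists b; split=> //; split=> //; exact/sub.
split=> //; have -> : tshift s b = tshift (tshift s c) (b - c).
  by rewrite tshiftD addrC subrK.
apply: (subtiles_tshift Tc) => //; last exact/sub.
by rewrite tshiftD addrC subrK.
Qed.

Lemma psupport_sigma n t b : tiles (T n.+2) (tshift t b) ->
  supp t `<=` psupport (sigma T n.+2 t).
Proof.
move=> Tt z tz; have [p [_ pT] pt] := ns_patch T_nested (isT : 2 <= n.+2)%N Tt.
have : supp (tshift t b) (z + b) by rewrite supp_tshiftE addrK.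
rewrite -pt => -[s ps sz].
exists (tshift s (- b)); last by rewrite supp_tshiftE opprK.
apply/(sigmaP _ Tt); rewrite tshiftNK; split; first exact: pT.
move=> y; rewrite supp_tshiftE opprK => sy.
have : psupport p (y + b) by exists s.
by rewrite pt supp_tshiftE addrK.
Qed.

Lemma sigma_tshift n t a s : sigma T n (tshift t a) s <->
  sigma T n t (tshift s (- a)).
Proof.
rewrite /sigma; case: ifP => _ /=.
  by split=> [->|<-]; rewrite ?tshiftK ?tshiftNK.
split=> -[b []]; rewrite !tshiftD => Tt sub.
  by exists (a + b); rewrite tshiftD addKr.
by exists (b - a); rewrite !tshiftD addrC subrK (addrC b).
Qed.

Lemma sigma_patch_pshift n p a :
  sigma_patch T n (pshift p a) = pshift (sigma_patch T n p) a.
Proof.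
apply/seteqP; split => s.
  by case=> t /pshiftE pt st; apply/pshiftE; exists (tshift t (- a)) => //;
    rewrite -sigma_tshift tshiftNK.
move=> /pshiftE[t pt st]; exists (tshift t a); first exact/pshift_tshift.
exact/sigma_tshift.
Qed.

Lemma sigma_comp_pshift n p a :
  sigma_comp T n (pshift p a) = pshift (sigma_comp T n p) a.
Proof. by elim: n p => //= n IH p; rewrite sigma_patch_pshift IH. Qed.

Lemma sigma_compS n p q : p `<=` q -> sigma_comp T n p `<=` sigma_comp T n q.
Proof.
elim: n p q => //= n IH p q pq; apply: IH => s [t pt st].
by exists t => //; exact: pq.
Qed.

Lemma sigma_patch1 p : sigma_patch T 1 p = p.
Proof.
by apply/seteqP; split => [s [t pt /= ->]//|s ps]; exists s.
Qed.

Lemma psupport_sigma_comp n p : (forall t, p t -> exists b, tiles (T n.+1) (tshift t b)) ->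
  psupport p `<=` psupport (sigma_comp T n.+1 p).
Proof.
elim: n p => [|n IH] p pT; first by rewrite /= sigma_patch1.
apply: subset_trans (IH (sigma_patch T n.+2 p) _) => [z [t pt tz]|s [t pt]].
  have [b Tt] := pT _ pt.
  by have [s st sz] := psupport_sigma Tt tz; exists s => //; exists t.
by have [b Tt] := pT _ pt; move=> /(sigmaP _ Tt)[]; exists b.
Qed.

End Nested.

(** * Towers and chains *)

Section Towers.
Variables (R : realType) (d : nat) (L : Type) (T : nat -> tiling R d L).
Hypotheses (T_nested : nested_sequence T) (T_proper : proper_sequence T).
Local Notation tile := (tile R d L).
Local Notation r n := (min_inner_radius (T n)).
Implicit Types (s t : tile) (p q : set tile) (a b w z : 'rV[R]_d) (n k : nat).
Implicit Types (X : nat -> set tile) (C : nat -> ctile R d L).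

(* Index [n] stands for level [n.+1], so [X 0] is the tiling of level 1: a tower
   is a limit of simultaneous translates of [T 1, T 2, ...]. *)
Definition tower X := (forall n t, X n t -> is_tile t) /\
  forall N M, exists w, forall n t, (n <= N)%N -> hits t M ->
    (X n t <-> pshift (T n.+1) w t).

Definition tower_collar X n s : set tile :=
  [set t | X n t /\ edist (supp s) (supp t) <= r n.+1].

Lemma hits_le t M M' : M <= M' -> hits t M -> hits t M'.
Proof. by move=> MM' [z tz zM]; exists z; rewrite ?(lt_le_trans zM). Qed.

Lemma hits_tshift t M a : hits t M -> hits (tshift t a) (M + enorm a).
Proof.
move=> [z tz zM]; exists (z + a); first by rewrite supp_tshiftE addrK.
by rewrite (le_lt_trans (enormD _ _))// ltrD2r.
Qed.

Lemma hits_punct t M : is_tile t -> enorm (punct t) < M -> hits t M.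
Proof. by move=> [_ _ tt] tM; exists (punct t). Qed.

Lemma tower_shift X a : tower X -> tower (fun n => pshift (X n) a).
Proof.
move=> [Xt Xw]; split=> [n _ [t /Xt tt <-]|N M]; first exact: is_tile_shift.
have [w wP] := Xw N (M + enorm (- a)); exists (w + a) => n t nN tM.
rewrite pshiftE -pshiftD pshiftE; apply: wP => //.
exact: hits_tshift.
Qed.

Lemma tower_T a : tower (fun n => pshift (T n.+1) a).
Proof.
by split=> [n _ [t /T_tile tt <-]|N M]; [exact: is_tile_shift|exists a].
Qed.

(** In each bounded region [X n] is a translate of [T n.+1], which settles the conditions on tiles
    and points; countability comes from a union over integer radii. *)
Lemma tower_tiling X n : tower X -> is_tiling (X n).
Proof.
move=> [Xt Xw]; split.
- have /choice[w wP] : forall M : nat, exists w, forall t, hits t M%:R ->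
      (X n t <-> pshift (T n.+1) w t).
    by move=> M; have [w wP] := Xw n M%:R; exists w => t; exact: wP.
  apply: (@sub_countable _ _ _ (\bigcup_M pshift (T n.+1) (w M))).
    apply: subset_card_le => t Xnt; exists (Num.truncn (enorm (punct t))).+1 => //.
    apply/wP => //; apply: hits_punct; [exact: Xt Xnt|exact: truncnS_gt].
  apply: bigcup_countable => // M _.
  by have [] := is_tiling_shift (w M) (tilingP (T n.+1)).
- by move=> t; exact: Xt.
- move=> s t Xs Xnt; pose M := Num.max (enorm (punct s)) (enorm (punct t)) + 1.
  have [w wP] := Xw n M.
  have [_ _ + _] := is_tiling_shift w (tilingP (T n.+1)); apply.
  + by apply/wP => //; apply: hits_punct; [exact: Xt Xs|];
      rewrite ltr_pwDr// le_max lexx.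
  + by apply/wP => //; apply: hits_punct; [exact: Xt Xnt|];
      rewrite ltr_pwDr// le_max lexx orbT.
- apply/seteqP; split => // z _; have [w wP] := Xw n (enorm z + 1).
  have [t tT tz] : psupport (pshift (T n.+1) w) z.
    by have [_ _ _ ->] := is_tiling_shift w (tilingP (T n.+1)).
  by exists t => //; apply/wP => //; exists z; rewrite // ltrDl.
Qed.

(** A single translation [w] serves levels [n] and [n.+1], so a parent found in [T n.+2] carries
    over to [X n.+1]. *)
Lemma tower_parent X n s : tower X -> X n s ->
  exists2 t, X n.+1 t & supp s `<=` supp t.
Proof.
move=> [Xt Xw] Xs; have sM := hits_punct (Xt _ _ Xs) (ltr_pwDr ltr01 (lexx _)).
have [w wP] := Xw n.+1 (enorm (punct s) + 1).
have [s' Ts s's] := (wP n s (leqnSn n) sM).1 Xs.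
have [t Tt st] := parent_exists T_nested Ts.
have st' : supp s `<=` supp (tshift t w).
  by move=> z; rewrite -s's !supp_tshiftE; exact: st.
exists (tshift t w) => //; apply/wP => //; last by exists t.
by case: sM => z /st'; exists z.
Qed.

Lemma tower_sigma X n t s : tower X -> X n.+1 t -> sigma T n.+2 t s -> X n s.
Proof.
move=> [Xt Xw] Xnt; have [M tM] := tile_bounded (Xt _ _ Xnt).
have [w wP] := Xw n.+1 M.
have tM' : hits t M by have [_ _ tt] := Xt _ _ Xnt; exists (punct t); [|exact: tM].
have /pshiftE Tt := (wP n.+1 t (leqnn _) tM').1 Xnt.
move=> /(sigmaP T_nested _ Tt)[Ts st]; apply/wP; [exact: leqnSn| |exact/pshiftE].
have [_ _ ss] := (is_tile_shiftE s (- w)).1 (T_tile Ts).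
by exists (punct s) => //; apply: tM; exact: st.
Qed.

Lemma tower_sigma_comp X n p : tower X -> p `<=` X n ->
  sigma_comp T n.+1 p `<=` X 0.
Proof.
move=> Xtow; elim: n p => [|n IH] p pX; first by rewrite /= sigma_patch1.
by apply: IH => s [t /pX Xnt]; exact: tower_sigma Xnt.
Qed.

Lemma tower_ctile X n s : tower X -> X n s -> exists M0, forall w,
  (forall t, hits t M0 -> (X n t <-> pshift (T n.+1) w t)) ->
  ctile_in T n.+1 (cshift (s, tower_collar X n s) (- w)).
Proof.
move=> [Xt Xw] Xs; have [M sM] := tile_bounded (Xt _ _ Xs).
have M0P t : is_tile t -> edist (supp s) (supp t) <= r n.+1 ->
    hits t (M + (r n.+1 + 1)).
  move=> tt /(edist_le_near (Xt _ _ Xs) tt)[z [z' [sz tz' zz']]].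
  exists z' => //; rewrite -[z'](subrK z) addrC.
  by rewrite (le_lt_trans (enormD _ _))// ltrD// ?sM// enormB.
(* Points of [s] have norm below [M], and each tile of its collar has a point within [r n.+1 + 1] of
   [s], so all these tiles hit the ball of this radius. *)
exists (M + (r n.+1 + 1)) => w wP.
have sm : hits s (M + (r n.+1 + 1)).
  have [_ _ ss] := Xt _ _ Xs; exists (punct s) => //.
  by rewrite (lt_trans (sM _ ss))// ltrDl addr_gt0// r_gt0.
split=> /=; first by apply/pshiftE/wP.
apply/seteqP; split => t.
  move=> /pshiftE; rewrite opprK => -[Xtw st]; split.
    have := (wP _ (M0P _ (Xt _ _ Xtw) st)).1 Xtw.
    by rewrite pshift_tshift.
  by rewrite -(tshiftK t w) edist_shift.
move=> [Tt st]; apply/pshiftE; rewrite opprK.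
have st' : edist (supp s) (supp (tshift t w)) <= r n.+1.
  by rewrite -(edist_shift _ _ (- w)) tshiftK.
split=> //; apply/wP; last by exists t.
by apply: M0P => //; exact/is_tile_shift/T_tile/Tt.
Qed.

(* As for towers, [C k] has level [k.+1].  The translation [b] may depend on
   [k]. *)
Definition linked C k := exists b,
  [/\ ctile_in T k.+1 (cshift (C k) b), ctile_in T k.+2 (cshift (C k.+1) b) &
      sigma T k.+2 (C k.+1).1 (C k).1].

Definition chain C := punct (C 0).1 = 0 /\ forall k, linked C k.

Lemma ctile_inE n c b : ctile_in T n (cshift c b) -> forall t,
  c.2 t <-> tiles (T n) (tshift t b) /\ edist (supp c.1) (supp t) <= r n.
Proof.
move=> [_ /= cE] t; rewrite -(pshift_tshift _ b) cE.
by rewrite -(edist_shift c.1 t b).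
Qed.

(** The first tile has its puncture at 0, and each tile contains the preceding one. *)
Lemma chain_supp C k : chain C -> supp (C k).1 0.
Proof.
move=> [C0 Cl]; elim: k => [|k IH].
  have [b [[/T_tile/is_tile_shiftE[_ _]]]] := Cl 0.
  by rewrite C0.
by have [b [_ [Tt _] /(sigmaP T_nested _ Tt)[_]]] := Cl k; apply.
Qed.

(** Passing from two tiles to their parents does not increase the distance, and $r_n$ grows with
    $n$; so the parent of a tile of one collar lies in the next collar. *)
Lemma chain_collar_sub C k : chain C ->
  (C k).2 `<=` sigma_patch T k.+2 (C k.+1).2.
Proof.
move=> [_ Cl] t; have [b [cin cin' csig]] := Cl k.
have Tt' : tiles (T k.+2) (tshift (C k.+1).1 b) by case: cin'.
have [Ts' cc'] := (sigmaP T_nested _ Tt').1 csig.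
move=> /(ctile_inE cin)[Tt ct]; have [t' T't tt'] := parent_exists T_nested Tt.
have tt'' : supp t `<=` supp (tshift t' (- b)).
  by move=> z tz; rewrite supp_tshiftE opprK; apply: tt'; rewrite supp_tshiftE addrK.
have T't'' : tiles (T k.+2) (tshift (tshift t' (- b)) b) by rewrite tshiftNK.
exists (tshift t' (- b)); last exact/(sigmaP T_nested _ T't'').
apply/(ctile_inE cin'); rewrite tshiftNK; split=> //.
apply: le_trans (r_incr T_proper k); apply: le_trans ct; apply: edist_subset => //.
- exact/tile_nonempty/(is_tile_shiftE _ b)/T_tile/Ts'.
- exact/tile_nonempty/(is_tile_shiftE _ b)/T_tile/Tt.
Qed.

(** The tile of [C k] contains 0, so a tile meeting this ball is at distance at most [r k.+1] from
    it. *)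
Lemma chain_cover C k : chain C -> eball 0 (r k.+1) `<=` psupport (C k).2.
Proof.
move=> Cc z; rewrite /eball/= => zr; have [_ /(_ k)[b [cin _ _]]] := Cc.
have [t Tt tz] : psupport (T k.+1) (z + b).
  by have [_ _ _ ->] := tilingP (T k.+1).
have tz' : supp (tshift t (- b)) z by rewrite supp_tshiftE opprK.
exists (tshift t (- b)) => //; apply/(ctile_inE cin); rewrite tshiftNK; split=> //.
by apply: (le_trans (edist_le (chain_supp k Cc) tz')); rewrite enormB ltW.
Qed.

(** If [w m] places [C m] in [T m.+1], the translates of [T n.+1] by [- w m] stabilize on every ball
    as [m] grows; their limits form the tower. *)
Lemma chain_tower C : chain C -> exists X, tower X /\ forall k, (C k).2 `<=` X k.
Proof.
move=> Cc; have [_ Cl] := Cc.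
have /choice[w wP] : forall k, exists b, ctile_in T k.+1 (cshift (C k) b).
  by move=> k; have [b [? _ _]] := Cl k; exists b.
(* Descending by [sigma] from the collar of [C (n + k)] recovers the collar of [C n]. *)
have step1 k n t : (C n).2 t -> tiles (T n.+1) (tshift t (w (n + k)%N)).
  elim: k n t => [|k IH] n t; first by rewrite addn0 => /(ctile_inE (wP n))[].
  move=> /(chain_collar_sub Cc)[t' /IH Tt' /(sigmaP T_nested _ Tt')[+ _]].
  by rewrite addnS addSn.
(* The tilings [T m.+1 - w m'] with [m' >= m] all contain the collar of [C m],
   so they agree near the origin; then so do the tilings of lower levels. *)
have base m k k' t : hits t (r m.+1) -> tiles (T m.+1) (tshift t (w (m + k)%N)) ->
    tiles (T m.+1) (tshift t (w (m + k')%N)).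
  move=> tm Tt; apply: (step1).
  apply: (@cover_mem _ _ _ (pshift (T m.+1) (- w (m + k)%N)) _ _ (eball 0 (r m.+1))).
  - exact/is_tiling_shift/tilingP.
  - by move=> s Cs; apply/pshiftE; rewrite opprK; exact: step1.
  - by apply/pshiftE; rewrite opprK.
  - exact: eball_open.
  - exact: chain_cover.
  - exact: hits_eball.
(* Agreement descends: the parent of a tile hits the same ball, and moving the parent by [v' - v]
   moves its subtiles along. *)
have down j n v v' M :
    (forall t, hits t M -> tiles (T (n + j).+1) (tshift t v) ->
      tiles (T (n + j).+1) (tshift t v')) ->
    forall t, hits t M -> tiles (T n.+1) (tshift t v) -> tiles (T n.+1) (tshift t v').
  elim: j n => [|j IH] n; first by rewrite addn0.
  rewrite addnS -addSn => /IH vv' t [z tz zM] Tt.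
  have [t' T't tt'] := parent_exists T_nested Tt.
  have T't' : tiles (T n.+2) (tshift (tshift t' (- v)) v) by rewrite tshiftNK.
  have t'm : hits (tshift t' (- v)) M.
    by exists z => //; rewrite supp_tshiftE opprK; apply: tt'; rewrite supp_tshiftE addrK.
  have -> : tshift t v' = tshift (tshift t v) (v' - v) by rewrite tshiftD addrC subrK.
  apply: (subtiles_tshift T_nested T't) => //.
  by rewrite addrC -tshiftD; exact: vv'.
have agree m m' n t : (n <= m)%N -> (m <= m')%N -> hits t (r m.+1) ->
    tiles (T n.+1) (tshift t (w m)) <-> tiles (T n.+1) (tshift t (w m')).
  move=> nm mm' tm.
  have bm k k' s : hits s (r m.+1) ->
      tiles (T (n + (m - n)).+1) (tshift s (w (m + k)%N)) ->
      tiles (T (n + (m - n)).+1) (tshift s (w (m + k')%N)).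
    by rewrite subnKC//; exact: base.
  have := (down _ _ _ _ _ (bm 0 (m' - m)%N) t tm, down _ _ _ _ _ (bm (m' - m)%N 0) t tm).
  by rewrite addn0 subnKC// => -[].
exists (fun n => [set t | exists m0, forall m, (m0 <= m)%N ->
  tiles (T n.+1) (tshift t (w m))]); split; last first.
  move=> k t Ct; exists k => m /subnKC <-; exact: step1.
split=> [n t [m0 /(_ m0 (leqnn _))/T_tile/is_tile_shiftE]//|N M].
(* The index [m] must be at least [N] for the levels and large enough that [r m.+1] exceeds [M]. *)
have [m0 Mm0] := r_unbounded T_proper M; pose m := maxn N m0.
exists (- w m) => n t nN tM; rewrite pshiftE opprK.
have nm : (n <= m)%N by rewrite (leq_trans nN) ?leq_maxl.
have tm : hits t (r m.+1).
  by apply: hits_le tM; rewrite (le_trans (ltW Mm0))// r_homo ?leq_maxr.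
split=> [[m1 /(_ (maxn m m1) (leq_maxr _ _))]|Tt].
  by rewrite -(agree m)// leq_maxl.
by exists m => m' mm'; rewrite -(agree m).
Qed.

(** Parents are chosen repeatedly, starting from [s], and each tile takes its collar in [X]. *)
Lemma tower_chain X s : tower X -> X 0 s -> punct s = 0 ->
  exists C, chain C /\ forall k, X k (C k).1 /\ (C k).2 = tower_collar X k (C k).1.
Proof.
move=> Xtow X0 s0.
have /choice[f fP] : forall ns : nat * tile, exists t, X ns.1 ns.2 ->
    X ns.1.+1 t /\ supp ns.2 `<=` supp t.
  move=> [n t] /=; have [Xnt|nX] := pselect (X n t); last by exists t.
  by have [t' ? ?] := tower_parent Xtow Xnt; exists t'.
pose S := nat_rect (fun _ => tile) s (fun k t => f (k, t)).
have XS k : X k (S k) by elim: k => //= k /(fP (k, S k))[].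
exists (fun k => (S k, tower_collar X k (S k))); split=> //=; split=> //= k.
have [M1 M1P] := tower_ctile Xtow (XS k).
have [M2 M2P] := tower_ctile Xtow (XS k.+1).
(* A link needs the same translation at both levels, so one [w] is taken for both collars. *)
have [_ /(_ k.+1 (Num.max M1 M2))[w wP]] := Xtow.
have c1 := M1P w (fun t tm => wP k t (leqnSn k) (hits_le _ tm)).
have c2 := M2P w (fun t tm => wP k.+1 t (leqnn _) (hits_le _ tm)).
exists (- w); split; [apply: c1|apply: c2|]; rewrite ?le_max ?lexx ?orbT//.
have [|T2 _] := c2; first by rewrite le_max lexx orbT.
apply/(sigmaP T_nested _ T2); split; last by have [] := fP (k, S k) (XS k).
by have [|] := c1; first by rewrite le_max lexx.
Qed.

End Towers.

(** * Paths and the map phi *)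

Section Paths.
Variables (R : realType) (d : nat) (L : Type) (T : nat -> tiling R d L).
Hypotheses (T_nested : nested_sequence T) (T_proper : proper_sequence T).
Local Notation tile := (tile R d L).
Local Notation tiling := (tiling R d L).
Local Notation r n := (min_inner_radius (T n)).
Local Notation dB := (set_type (@infinite_paths R d L T)).
Implicit Types (s t : tile) (p q : set tile) (a b w z : 'rV[R]_d) (n k : nat).
Implicit Types (X : nat -> set tile) (C : nat -> ctile R d L) (x y : dB).

Lemma cshiftD (c : ctile R d L) a b : cshift (cshift c a) b = cshift c (a + b).
Proof. by rewrite /cshift/= tshiftD pshiftD. Qed.

Lemma cshiftNK (c : ctile R d L) a : cshift (cshift c (- a)) a = c.
Proof. by case: c => t p; rewrite /cshift/= tshiftNK pshiftNK. Qed.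

Lemma cshiftK (c : ctile R d L) a : cshift (cshift c a) (- a) = c.
Proof. by case: c => t p; rewrite /cshift/= tshiftK pshiftK. Qed.

Definition pointed_ctile (c : ctile R d L) : ctile R d L :=
  cshift c (- punct c.1).

(** A path and a chain carry the same data: the vertex is the class of [C k], and the label of the
    prefix is the position of its puncture. *)
Definition path_chain x C := chain T C /\ forall k,
  erng (set_val x k) = Some (pointed_ctile (C k)) /\
  path_label (path_prefix x k.+1) = punct (C k).1.

Lemma path_label1 x : path_label (path_prefix x 1) = elab (set_val x 0%N).
Proof. by rewrite /path_label big_seq1. Qed.

Lemma path_labelS x k : path_label (path_prefix x k.+1) =
  path_label (path_prefix x k) + elab (set_val x k).
Proof. by rewrite /path_label /path_prefix mkseqS big_rcons. Qed.

Lemma path_edges x k : edges T k.+1 (set_val x k) /\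
  erng (set_val x k) = esrc (set_val x k.+1).
Proof. exact: (set_valP x k). Qed.

(** The [k]-th vertex is moved by the label [u k] of the prefix. An edge labelled [- a] gives
    [u k = u k.+1 + a], which is the position of the small tile inside the large one. *)
Lemma path_chain_exists x : exists C, path_chain x C.
Proof.
have /choice[c cP] : forall k, exists c, erng (set_val x k) = Some c /\
    punct c.1 = 0.
  case=> [|k].
    by have [[_ [c [c0 _] <-] <-] _] := path_edges x 0; exists c.
  have [xe _] := path_edges x k.+1.
  by move: xe => [c [c' [a [b [-> [_ [c'0 _]] _ _ _]]]]]; exists c'.
pose u k := path_label (path_prefix x k.+1).
have pu k : punct (cshift (c k) (u k)).1 = u k.
  by have [_] := cP k; rewrite /= => ->; rewrite add0r.
exists (fun k => cshift (c k) (u k)); split; last first.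
  by move=> k; rewrite /pointed_ctile pu cshiftK; have [-> _] := cP k.
split=> [|k].
  rewrite pu /u path_label1; have [] := path_edges x 0.
  by move=> [v _ <-].
have [xe _] := path_edges x k.+1; have [_ xs] := path_edges x k.
have [ck _] := cP k; have [ck' _] := cP k.+1.
move: xe => [c1 [c1' [a [b [xE _ csig cin' cin]]]]].
have c1E : c1 = c k by move: xs; rewrite ck xE => -[].
have c1'E : c1' = c k.+1 by move: ck'; rewrite xE => -[].
subst c1 c1'.
have uS : u k.+1 = u k - a by rewrite /u path_labelS xE.
exists (b - u k.+1); split.
- rewrite cshiftD uS opprB (_ : u k + (b + (a - u k)) = a + b)//.
  by rewrite addrCA (addrC (u k)) subrK addrC.
- by rewrite cshiftD addrC subrK.
- rewrite /=; apply/sigma_tshift; rewrite tshiftD (_ : _ - _ = a)// uS opprB addrC.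
  by rewrite subrK.
Qed.

Lemma collared_pointed n c b : ctile_in T n (cshift c b) ->
  collared_prototiles T n (pointed_ctile c).
Proof.
move=> cin; split; first by rewrite /= subrr.
by exists (punct c.1 + b); rewrite /pointed_ctile cshiftD addKr.
Qed.

(** The edge labels are the differences of successive punctures; the first is 0 because [C 0] has
    its puncture at 0. *)
Lemma chain_path_exists C : chain T C -> exists x, path_chain x C.
Proof.
move=> Cc; have [C0 Cl] := Cc.
pose c k := pointed_ctile (C k).
pose f k := if k is m.+1 then
    Edge (Some (c m)) (Some (c k)) (punct (C k).1 - punct (C m).1)
  else Edge None (Some (c 0%N)) 0.
have fP : infinite_paths T f.
  case=> [|k]; split=> //=.
    exists (Some (c 0%N)) => //; exists (c 0%N) => //.
    by have [b [cin _ _]] := Cl 0%N; exact: collared_pointed cin.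
  have [b [cin cin' csig]] := Cl k.
  exists (c k), (c k.+1), (punct (C k).1 - punct (C k.+1).1),
    (punct (C k.+1).1 + b); split.
  - by rewrite opprB.
  - by split; [exact: collared_pointed cin|exact: collared_pointed cin'].
  - apply/sigma_tshift; rewrite tshiftD opprK subrK.
    by rewrite -[X in sigma _ _ _ X]/(cshift (c k) _).1 cshiftNK.
  - by rewrite /c /pointed_ctile cshiftD addKr.
  - by rewrite addrA subrK /c /pointed_ctile cshiftD addKr.
exists (exist _ (f : {ptws nat -> discrete_topology (edge R d L)}) (mem_set fP)).
split=> // k; split; first by case: k.
elim: k => [|k IH]; first by rewrite path_label1 C0.
by rewrite path_labelS IH /= addrC subrK.
Qed.

Lemma path_patchE x C k : path_chain x C ->
  path_patch T (path_prefix x k.+1) = sigma_comp T k.+1 (C k).2.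
Proof.
move=> [_ /(_ k)[xk ul]]; rewrite /path_patch ul.
have -> : path_range (path_prefix x k.+1) = erng (set_val x k).
  by rewrite /path_range /path_prefix mkseqS map_rcons last_rcons.
by rewrite xk size_mkseq sigma_comp_pshift pshiftNK.
Qed.

Lemma chain_patch_cover C k : chain T C ->
  eball 0 (r k.+1) `<=` psupport (sigma_comp T k.+1 (C k).2).
Proof.
move=> Cc; apply: (subset_trans (chain_cover T_nested Cc)).
apply: psupport_sigma_comp => // t; have [_ /(_ k)[b [cin _ _]]] := Cc.
by move=> /(ctile_inE cin)[]; exists b.
Qed.

(** * Neighbourhoods of tilings and the values of [phi] *)

Lemma eball_le (z : 'rV[R]_d) M M' : M <= M' -> eball z M `<=` eball z M'.
Proof. by move=> MM' y /= /lt_le_trans; exact. Qed.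

Lemma delta_lt (S S' : tiling) (e : R) : 0 < e ->
  (forall t, enorm (punct t) < Num.max 2 (e^-1 + 1) ->
    (tiles S t <-> tiles S' t)) -> delta S S' < e.
Proof.
(* The witness is $1/M$ with both translations 0: the 2 makes it less than 1, the other term makes
   it less than [e]. *)
move=> e0; set M := Num.max _ _ => SS'.
have M2 : 2 <= M by rewrite le_max lexx.
have M0 : 0 < M by rewrite (lt_le_trans _ M2).
have Me : M^-1 < e.
  rewrite -[e]invrK ltf_pV2 ?posrE ?invr_gt0//.
  by rewrite lt_max ltrDl ltr01 orbT.
apply: le_lt_trans Me; apply: ge_inf.
  by exists 0 => y [[/andP[/ltW ? _] _]|->].
left; split.
  by rewrite invr_gt0 M0 invf_lt1// (lt_le_trans _ M2)// ltr1n.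
exists 0, 0; rewrite /eball/= subrr enorm0 invr_gt0; split=> // t.
by rewrite subr0 invrK !pshift0; exact: SS'.
Qed.

Lemma nbhs_agree (S : tiling) (A : set tiling) : nbhs S A ->
  exists M, forall S' : tiling,
    (forall t, enorm (punct t) < M -> (tiles S t <-> tiles S' t)) -> A S'.
Proof.
rewrite nbhsE => -[U [oU US] UA]; have [e e0 eU] := oU S US.
exists (Num.max 2 (e^-1 + 1)) => S' SS'; apply/UA/eU.
exact: delta_lt.
Qed.

(** A common patch that covers the ball contains every tile of either tiling with its puncture
    there. *)
Lemma nbhs_cover (S : tiling) (A : set tiling) : nbhs S A ->
  exists M, forall (S' : tiling) p, p `<=` S -> p `<=` S' ->
    eball 0 M `<=` psupport p -> A S'.
Proof.
move=> /nbhs_agree[M MA]; exists M => S' p pS pS' Mp; apply: MA => t tM.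
have pt (S0 : tiling) : p `<=` S0 -> tiles S0 t -> p t.
  move=> pS0 St; apply: (cover_mem (tilingP S0) pS0 St _ Mp) => //.
    exact: eball_open.
  have [_ /(_ _ St)[_ _ tt] _ _] := tilingP S0.
  by exists (punct t); rewrite /eball/= subr0.
by split=> [/(pt _ pS)/pS'|/(pt _ pS')/pS].
Qed.

Lemma tower_transversal X s (S : tiling) : tower T X -> X 0%N s -> punct s = 0 ->
  tiles S = X 0%N -> transversal (T 1) S.
Proof.
move=> Xtow Xs s0 SX; split; last by exists s; rewrite ?SX.
move=> A /nbhs_agree[M MA]; have [Xt Xw] := Xtow.
have [w wP] := Xw 0%N M.
pose S' := Tiling (is_tiling_shift w (tilingP (T 1))).
exists S'; split; first by exists w.
apply: MA => t tM; rewrite SX; split=> [X0t|S't].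
  by apply/wP => //; apply: hits_punct => //; exact: Xt X0t.
apply/wP => //; apply: hits_punct => //.
by have [_ + _ _] := tilingP S'; apply.
Qed.

(** The tiling [S] witnesses that the choice defining [phi x] is not the default. Both tilings
    contain the patches of the chain, which cover arbitrarily large balls. *)
Lemma phi_eq x C (S : tiling) : path_chain x C -> transversal (T 1) S ->
  (forall k, sigma_comp T k.+1 (C k).2 `<=` S) -> phi x = S.
Proof.
move=> xC TS pS; have Cc : chain T C by case: xC.
have [_ pphi] : transversal (T 1) (phi x) /\
    forall n, (1 <= n)%N -> path_patch T (path_prefix x n) `<=` phi x.
  rewrite /phi; apply: (@xgetPex _ _ [set S | transversal (T 1) S /\ _]).
  by exists S; split=> // -[//|k] _; rewrite (path_patchE k xC).
have cov M : exists p, [/\ p `<=` phi x, p `<=` S & eball 0 M `<=` psupport p].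
  have [k Mk] := r_unbounded T_proper M.
  exists (sigma_comp T k.+1 (C k).2); split=> //.
    by rewrite -(path_patchE k xC); exact: pphi.
  by apply: (subset_trans (eball_le (ltW Mk))); exact: chain_patch_cover.
apply: tiling_eq; apply/seteqP; split.
  exact: tiling_subset (tilingP _) cov.
apply: tiling_subset (tilingP _) _ => M.
by have [p [? ? ?]] := cov M; exists p.
Qed.

Lemma phi_tower x C X s : path_chain x C -> tower T X -> X 0%N s -> punct s = 0 ->
  (forall k, (C k).2 `<=` X k) -> tiles (phi x) = X 0%N.
Proof.
move=> xC Xtow Xs s0 CX; have Xtil := tower_tiling 0 Xtow.
rewrite (@phi_eq _ _ (Tiling Xtil) xC)//; first exact: tower_transversal Xs _ _.
by move=> k; exact: tower_sigma_comp.
Qed.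

Lemma chain_self C k : chain T C -> (C k).2 (C k).1.
Proof.
move=> Cc; have [_ /(_ k)[b [cin _ _]]] := Cc.
apply/(ctile_inE cin); split; first by case: cin.
have C0 := chain_supp T_nested k Cc.
by rewrite (le_trans (edist_le C0 C0))// subrr enorm0 ltW// r_gt0.
Qed.

Lemma path_tower x : exists X, tower T X /\ tiles (phi x) = X 0%N.
Proof.
have [C xC] := path_chain_exists x; have Cc : chain T C by case: xC.
have [X [Xtow CX]] := chain_tower T_nested T_proper Cc.
exists X; split=> //; have [C0 _] := Cc.
exact: (phi_tower xC Xtow (CX 0%N _ (chain_self 0 Cc)) C0 CX).
Qed.

Lemma phi_transversal x : transversal (T 1) (phi x).
Proof.
have [C xC] := path_chain_exists x; have Cc : chain T C by case: xC.
have [X [Xtow CX]] := chain_tower T_nested T_proper Cc; have [C0 _] := Cc.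
have CX0 := CX 0%N _ (chain_self 0 Cc).
exact: tower_transversal Xtow CX0 C0 (phi_tower xC Xtow CX0 C0 CX).
Qed.

Lemma phi_patch x C k : path_chain x C -> sigma_comp T k.+1 (C k).2 `<=` phi x.
Proof.
move=> xC; have Cc : chain T C by case: xC.
have [X [Xtow CX]] := chain_tower T_nested T_proper Cc; have [C0 _] := Cc.
rewrite (phi_tower xC Xtow (CX 0%N _ (chain_self 0 Cc)) C0 CX).
exact: tower_sigma_comp.
Qed.

Lemma tower_path X s : tower T X -> X 0%N s -> punct s = 0 ->
  exists x C, [/\ path_chain x C, tiles (phi x) = X 0%N &
    forall k, X k (C k).1 /\ (C k).2 = tower_collar T X k (C k).1].
Proof.
move=> Xtow Xs s0; have [C [Cc CX]] := tower_chain T_nested T_proper Xtow Xs s0.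
have [x xC] := chain_path_exists Cc; exists x, C; split=> //.
apply: (phi_tower xC Xtow Xs s0) => k.
by have [_ ->] := CX k; move=> t [].
Qed.

(** * Equivalent paths and translated tilings *)

Lemma path_equiv_translate x y : path_equiv x y ->
  exists a, tiles (phi y) = pshift (tiles (phi x)) a.
Proof.
move=> [n0 [h [n0_gt0 [hh hd]]]].
have [C xC] := path_chain_exists x; have [C' yC] := path_chain_exists y.
have [Cc xP] := xC; have [Cc' yP] := yC.
(* [K k] compares the position reached along [x] and then [h] with the one reached along [y]; the
   commutative diagrams make it constant. [C k] has level [k.+1], hence the index of [h]. *)
pose K k := punct (C k).1 + elab (h k.+1) - punct (C' k).1.
have KS k : (n0 <= k.+1)%N -> K k.+1 = K k.
  move=> n0k; have [_ _ _ _ lab] := hd k.+2 n0k.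
  rewrite /K -(xP k.+1).2 -(yP k.+1).2 path_labelS (path_labelS y).
  rewrite (xP k).2 (yP k).2 -!addrA (addrA (elab _)) /= lab.
  rewrite opprD [_ - _ in LHS]addrC !addrA; congr (_ + _).
  by rewrite -addrA subrr addr0.
have Kconst k : (n0 <= k.+1)%N -> K k = K n0.-1.
  elim: k => [|k IH]; first by case: n0 n0_gt0 {hh hd KS} => [//|[]].
  rewrite leq_eqVlt => /predU1P[->//|n0k]; rewrite KS//; exact: IH.
exists (- K n0.-1).
suff cov M : exists p, [/\ p `<=` phi x, p `<=` pshift (phi y) (K n0.-1) &
    eball 0 M `<=` psupport p].
  have -> : tiles (phi x) = pshift (phi y) (K n0.-1); last by rewrite pshiftK.
  apply/seteqP; split; first exact: tiling_subset (tilingP _) cov.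
  apply: tiling_subset (is_tiling_shift _ (tilingP _)) _ => M.
  by have [p [? ? ?]] := cov M; exists p.
(* The collar of [C' k] covers a ball around 0, so after translation by [K] it covers one around
   [K]; the term [enorm (K n0.-1)] makes up for this. *)
have [k0 Mk0] := r_unbounded T_proper (M + enorm (K n0.-1)).
pose k := maxn k0 n0; have n0k : (n0 <= k.+1)%N by rewrite leqW// leq_maxr.
have Mk : M + enorm (K n0.-1) < r k.+1.
  by rewrite (lt_le_trans Mk0)// r_homo// leq_maxl.
have KE := Kconst _ n0k; rewrite -{}KE in Mk *.
have [hs hr _ _ _] := hd k.+2 n0k.
have [c [c' [a [a' [hE _ [cin cin'] _ _]]]]] := hh k.+1 n0k.
have cE : c = pointed_ctile (C k).
  move: hs; rewrite /= hE /= -(path_edges x k).2 (xP k).1 => -[]; exact.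
have c'E : c' = pointed_ctile (C' k).
  move: hr; rewrite /= hE /= -(path_edges y k).2 (yP k).1 => -[]; exact.
(* The vertex has its puncture at 0 and is placed by [a]; [b] places [C k] itself, and [b + K k]
   then places [C' k]. *)
pose b := a - punct (C k).1.
have {cE}cin : ctile_in T k.+1 (cshift (C k) b).
  by move: cin; rewrite cE /pointed_ctile cshiftD addrC.
have {c'E}cin' : ctile_in T k.+1 (cshift (C' k) (b + K k)).
  move: cin'; rewrite c'E /pointed_ctile cshiftD addrC; congr (ctile_in _ _ (cshift _ _)).
  by rewrite /b /K hE /= -!addrA addKr addrCA addNKr.
(* Both collars embed in [T k.+1] by the same translation [b], so they share all tiles near the
   origin. *)
pose p := (C k).2 `&` pshift (C' k).2 (K k).
have pT t : p t -> tiles (T k.+1) (tshift t b).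
  by move=> [/(ctile_inE cin)[]].
exists (sigma_comp T k.+1 p); split.
- apply: (subset_trans _ (phi_patch xC)); apply: sigma_compS.
  exact: subIsetl.
- apply: (subset_trans _ (pshiftS (phi_patch yC))).
  rewrite -sigma_comp_pshift.
  by apply: sigma_compS; exact: subIsetr.
apply: (subset_trans _ (psupport_sigma_comp T_nested _)); last first.
  by move=> t /pT; exists b.
move=> z; rewrite /eball/= subr0 => zM.
have [t Tt tz] : psupport (T k.+1) (z + b).
  by have [_ _ _ ->] := tilingP (T k.+1).
have tz' : supp (tshift t (- b)) z by rewrite supp_tshiftE opprK.
exists (tshift t (- b)) => //; split.
  apply/(ctile_inE cin); rewrite tshiftNK; split=> //.
  apply: (le_trans (edist_le (chain_supp T_nested k Cc) tz')).
  rewrite sub0r enormN ltW// (lt_trans zM)// (le_lt_trans _ Mk)//.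
  by rewrite lerDl enorm_ge0.
apply/pshiftE; apply/(ctile_inE cin'); rewrite !tshiftD.
rewrite [- K k + _]addrC addrK addNr tshift0; split=> //.
have tzK : supp (tshift t (- b - K k)) (z - K k).
  by rewrite -tshiftD supp_tshiftE opprK subrK.
apply: (le_trans (edist_le (chain_supp T_nested k Cc') tzK)).
rewrite sub0r enormN ltW// (le_lt_trans (enormD _ _))// enormN.
by rewrite (lt_le_trans _ (ltW Mk))// ltrD2r.
Qed.

Lemma translate_path_equiv x y a : injective (@phi R d L T) ->
  tiles (phi y) = pshift (tiles (phi x)) a -> path_equiv x y.
Proof.
move=> phi_inj yxa; have [X [Xtow xX]] := path_tower x.
have [_ [s phis s0]] := phi_transversal x; have [_ [s' phis' s'0]] := phi_transversal y.
rewrite xX in phis; rewrite yxa xX in phis'.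
have [x1 [C [xC x1X CX]]] := tower_path Xtow phis s0.
have [y1 [C' [yC y1X C'X]]] := tower_path (tower_shift a Xtow) phis' s'0.
(* Injectivity of [phi] identifies the paths read off from [X] and from its translate with the given
   ones. *)
have ? : x1 = x by apply/phi_inj/tiling_eq; rewrite x1X xX.
have ? : y1 = y by apply/phi_inj/tiling_eq; rewrite y1X yxa xX.
subst x1 y1; have [Cc xP] := xC; have [Cc' yP] := yC.
(* The chain of [y] is moved back, so that both chains consist of collared tiles of [X]. *)
pose D k := cshift (C' k) (- a).
have DX k : X k (D k).1 by apply/pshiftE; have [] := C'X k.
have DE k : D k = ((D k).1, tower_collar T X k (D k).1).
  rewrite [LHS]surjective_pairing; congr pair; rewrite /D /=.
  have [_ ->] := C'X k; apply/seteqP; split => t.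
    move=> /pshiftE; rewrite opprK => -[/pshift_tshift Xt]; split=> //.
    by rewrite -(edist_shift _ _ a) tshiftNK.
  move=> [Xt st]; apply/pshiftE; rewrite opprK; split; first exact/pshift_tshift.
  by rewrite -(edist_shift _ _ (- a)) tshiftK.
have CE k : C k = ((C k).1, tower_collar T X k (C k).1).
  by rewrite [LHS]surjective_pairing; congr pair; have [_ ->] := CX k.
(* The tiles of [C k] and [D k] contain 0 and [- a], so their distance is at most [enorm a]. *)
have [k0 ak0] := r_unbounded T_proper (enorm a).
have dist k : (k0 <= k)%N -> edist (supp (C k).1) (supp (D k).1) <= r k.+1.
  move=> k0k; have := chain_supp T_nested k Cc => C0.
  have Da : supp (D k).1 (- a).
    by rewrite supp_tshiftE subrr; exact: chain_supp Cc'.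
  apply: (le_trans (edist_le C0 Da)); rewrite sub0r opprK.
  by rewrite (le_trans (ltW ak0))// r_homo.
pose h n := Edge (erng (set_val x n.-1)) (erng (set_val y n.-1))
  (punct (D n.-1).1 - punct (C n.-1).1).
exists k0.+1, h; split=> //; split; last first.
  case=> [//|[//|k]] _; split=> //=; try by case: (path_edges x k);
    case: (path_edges y k).
  have ex : elab (set_val x k.+1) = punct (C k.+1).1 - punct (C k).1.
    by rewrite -(xP k).2 -(xP k.+1).2 path_labelS addrC addKr.
  have ey : elab (set_val y k.+1) = punct (C' k.+1).1 - punct (C' k).1.
    by rewrite -(yP k).2 -(yP k.+1).2 path_labelS addrC addKr.
  by rewrite ex ey; apply/rowP => i; rewrite !mxE; ring.
case=> [//|k] k0k.
have [M1 M1P] := tower_ctile T_proper Xtow (CX k).1.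
have [M2 M2P] := tower_ctile T_proper Xtow (DX k).
have [_ /(_ k (Num.max M1 M2))[w wP]] := Xtow.
have cin : ctile_in T k.+1 (cshift (C k) (- w)).
  rewrite CE; apply: M1P => t tm; apply: wP => //; apply: hits_le tm.
  by rewrite le_max lexx.
have din : ctile_in T k.+1 (cshift (D k) (- w)).
  rewrite DE; apply: M2P => t tm; apply: wP => //; apply: hits_le tm.
  by rewrite le_max lexx orbT.
have pD : pointed_ctile (D k) = pointed_ctile (C' k).
  by rewrite /pointed_ctile /D cshiftD/= opprD opprK addrA addrAC addNr add0r.
have pK c : cshift (pointed_ctile c) (punct c.1 - w) = cshift c (- w).
  by rewrite /pointed_ctile cshiftD addKr.
exists (pointed_ctile (C k)), (pointed_ctile (D k)),
  (punct (C k).1 - w), (punct (D k).1 - w); rewrite !pK; split.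
- by rewrite /h /= (xP k).1 (yP k).1 -pD; congr Edge; rewrite opprB addrA subrK.
- by split; [exact: collared_pointed cin|exact: collared_pointed din].
- by [].
- apply/pshift_tshift; rewrite DE; split; first by have [] := CX k.
  by rewrite edistC; exact: dist.
- apply/pshift_tshift; rewrite CE; split; first exact: DX.
  exact: dist.
Qed.

End Paths.

(** * Compactness and continuity *)

Section Finiteness.
Variables (R : realType) (d : nat) (L : Type) (T : nat -> tiling R d L).
Hypotheses (T_nested : nested_sequence T) (T_proper : proper_sequence T).
Local Notation tile := (tile R d L).
Local Notation r n := (min_inner_radius (T n)).
Implicit Types (s t : tile) (p q : set tile) (n k : nat).

Lemma collar_bounded n : exists2 K, 0 <= K & forall t, tiles (T n.+1) t ->
  forall t', collar T n.+1 t t' -> supp t' `<=` ecball (punct t) K.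
Proof.
have [M M0 TM] := outer_ball T_proper n.
(* The route goes from the puncture of [t] to its point near [t'], across the gap, to the puncture
   of [t'], and on to [y]. *)
exists (M + (r n.+1 + 1) + M + M).
  by rewrite !addr_ge0// ltW// r_gt0.
move=> t Tt t' [Tt' tt'] y t'y; rewrite /ecball/=.
have [z [z' [tz t'z' zz']]] := edist_le_near (T_tile Tt) (T_tile Tt') tt'.
have -> : y - punct t = (z - punct t) - (z - z') - (z' - punct t') + (y - punct t').
  by apply/rowP => i; rewrite !mxE; ring.
apply: (le_trans (enormD _ _)); apply: lerD; last exact: TM.
apply: (le_trans (enormD _ _)); rewrite enormN; apply: lerD; last exact: TM.
apply: (le_trans (enormD _ _)); rewrite enormN; apply: lerD; last exact: ltW.
exact: TM.
Qed.

Lemma collar_self n t : tiles (T n.+1) t -> collar T n.+1 t t.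
Proof.
move=> Tt; split=> //; have [_ _ tt] := T_tile Tt.
by rewrite (le_trans (edist_le tt tt))// subrr enorm0 ltW// r_gt0.
Qed.

Lemma collar_patches n : exists F : set (set tile), finite_set F /\
  forall t p, tiles (T n.+1) t -> finite_set p -> p t -> p `<=` collar T n.+1 t ->
    exists q s, [/\ F q, finite_set q, q s &
      t = tshift s (punct t - punct s) /\ p = pshift q (punct t - punct s)].
Proof.
have [K K0 TK] := collar_bounded n.
have K10 : 0 < K + 1 by rewrite ltr_wpDl.
have [F [Ffin FP]] := pr_FLC T_proper (isT : 1 <= n.+1)%N K10.
exists F; split=> // t p Tt pfin pt pcol.
have out : outer_radius (punct t) (psupport p) < K + 1.
  rewrite (@le_lt_trans _ _ K) ?ltrDl//; apply: ge_inf.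
    by exists 0 => e [].
  by split=> // z [t' /pcol /(TK _ Tt)]; exact.
have pT : patch_of (T n.+1) p by split=> // t' /pcol[].
have [q [a [Fq pE]]] := FP p t pT pt out.
move: (pt); rewrite pE => -[s qs st].
have aE : a = punct t - punct s by rewrite -st /= addrC addKr.
exists q, s; split=> //; last by rewrite -aE -pE.
by rewrite -(pshiftK q a) -pE; exact: finite_image.
Qed.

(* FLC is only used for the patches [{t, t'}] here: they are translates of
   finitely many finite patches, hence there are finitely many [t']. *)
Lemma collar_finite n t : tiles (T n.+1) t -> finite_set (collar T n.+1 t).
Proof.
move=> Tt; have [F [Ffin FP]] := collar_patches n.
apply: (@sub_finite_set _ _ (\bigcup_(q in F `&` [set q | finite_set q])
    \bigcup_(s in q) pshift q (punct t - punct s))).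
  move=> t' tt'; have [|||q [s [Fq qfin qs [_ pE]]]] := FP t [set t; t'] Tt.
  - exact: finite_set2.
  - by left.
  - by move=> _ [->|->] //; exact: collar_self.
  exists q => //; exists s => //; rewrite -pE; by right.
apply: bigcup_finite => [|q [_ qfin]]; first exact/finite_setIl.
by apply: bigcup_finite => // s qs; exact: finite_image.
Qed.

(** A collared prototile is determined by one of finitely many finite patches and a tile of that
    patch. *)
Lemma collared_prototiles_finite n : finite_set (collared_prototiles T n.+1).
Proof.
have [F [Ffin FP]] := collar_patches n.
apply: (@sub_finite_set _ _ (\bigcup_(q in F `&` [set q | finite_set q])
    (fun s => pointed_ctile (s, q)) @` q)).
  move=> c [c0 [b [Tc cE]]].
  have [|||q [s [Fq qfin qs [tE pE]]]] := FP (tshift c.1 b) (pshift c.2 b) Tc.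
  - by move: cE => /= ->; exact: collar_finite.
  - by move: cE => /= ->; exact: collar_self.
  - by move: cE => /= ->.
  exists q => //; exists s => //; rewrite [RHS]surjective_pairing.
  have bE : punct (tshift c.1 b) - punct s - b = - punct s.
    by rewrite /= c0 add0r addrC addKr.
  rewrite /pointed_ctile /cshift/=; congr pair.
    by rewrite -bE -tshiftD -tE tshiftK.
  by rewrite -bE -pshiftD -pE pshiftK.
apply: bigcup_finite => [|q [_ qfin]]; first exact/finite_setIl.
exact: finite_image.
Qed.

(** Above the first level, an edge is determined by its two vertices and a tile of the finite patch
    of its range: the source has its puncture at 0, so [a] is the puncture of that tile. *)
Lemma edges_finite n : finite_set (edges T n.+1).
Proof.
case: n => [|n].
  apply: (finite_image (fun v => Edge None v 0)); apply: finite_image.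
  exact: collared_prototiles_finite.
pose P := collared_prototiles T n.+2.
apply: (@sub_finite_set _ _ (\bigcup_(c' in P)
    (fun cs => Edge (Some cs.1) (Some c') (- punct cs.2)) @`
      (collared_prototiles T n.+1 `*` sigma T n.+2 c'.1))).
  move=> _ [c [c' [a [b [-> [Pc Pc'] csig _ _]]]]].
  exists c' => //; exists (c, tshift c.1 a); first by split.
  by case: Pc => c0 _; rewrite /= c0 add0r.
apply: bigcup_finite => [|c' [_ [b [Tc _]]]]; first exact: collared_prototiles_finite.
apply/finite_image/finite_setX; first exact: collared_prototiles_finite.
have [fin _] := pr_patch T_proper (isT : 2 <= n.+2)%N Tc.
rewrite -(pshiftK (sigma T n.+2 c'.1) b); apply: finite_image.
rewrite (_ : pshift _ _ = sigma T n.+2 (tshift c'.1 b))//.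
by apply/seteqP; split => s /=; rewrite pshiftE sigma_tshift.
Qed.

End Finiteness.

(** * The topology of the path space and of the transversal *)

Section Topology.
Variables (R : realType) (d : nat) (L : Type) (T : nat -> tiling R d L).
Hypotheses (T_nested : nested_sequence T) (T_proper : proper_sequence T).
Local Notation tile := (tile R d L).
Local Notation tiling := (tiling R d L).
Local Notation r n := (min_inner_radius (T n)).
Local Notation dB := (set_type (@infinite_paths R d L T)).
Local Notation Xi := (set_type (transversal (T 1))).
Implicit Types (s t : tile) (p q : set tile) (n k : nat).

Lemma compact_set_type (X : topologicalType) (A : set X) :
  compact A -> compact [set: set_type A].
Proof.
move=> cA F FF _.
have [|x [Ax xF]] := cA (set_val @ F) _.
  by apply: (@filterS _ F _ setT) => [y _|]; [exact: set_valP|exact: filterT].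
exists (exist _ x (mem_set Ax)); split=> // B C FB [_ [[V oV <-] Vx] VC].
have FB' : (set_val @ F) (set_val @` B).
  by apply: (@filterS _ F _ B) => // y By; exists y.
have [_ [[y By <-] Vy]] := xF _ V FB' (open_nbhs_nbhs (conj oV Vx)).
by exists y; split=> //; exact: VC.
Qed.

Lemma nbhs_coord (x : {ptws nat -> discrete_topology (edge R d L)}) k :
  \forall y \near x, y k = x k.
Proof.
have := @proj_continuous _ (fun _ : nat => discrete_topology (edge R d L)) k x.
by move=> /(_ [set x k]); apply; exact: discrete_set1.
Qed.

(** The product of the finite edge sets is compact by Tychonoff, and each matching condition is
    closed as it involves two discrete coordinates. *)
Lemma infinite_paths_compact : compact (@infinite_paths R d L T).
Proof.
pose A k : set (discrete_topology (edge R d L)) := edges T k.+1.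
have cA k : compact (A k) by apply: finite_compact; exact: edges_finite.
apply: subclosed_compact (tychonoff cA) _; last by move=> x xP k; case: (xP k).
move=> x xcl k.
have [|y [/(_ k)[yk yk'] [<- <-]]] := xcl [set y | y k = x k /\ y k.+1 = x k.+1].
  by apply: filterI; exact: nbhs_coord.
by [].
Qed.

Lemma nbhs_path_prefix (x : dB) n :
  \forall y \near x, path_prefix y n = path_prefix x n.
Proof.
elim: n => [|n IH].
  by apply: (@filterS _ (nbhs x) _ setT) => [y|]; [|exact: filterT].
have sv : \forall y \near x, set_val y n = set_val x n.
  exact: (@initial_continuous _ _ set_val x _ (nbhs_coord (set_val x) n)).
apply: (@filterS2 _ (nbhs x) _ _ _ _ _ IH sv) => y IHy yn.
by rewrite /path_prefix !mkseqS yn; congr rcons.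
Qed.

(** The metric tolerates small translations, so only a translate of [p] persists. The condition is
    shown to be open at each tiling [S1] satisfying it, using the slack [e - enorm a]. *)
Lemma nbhs_patch (S : tiling) p M e : 0 < e -> p `<=` S ->
  (forall t, p t -> enorm (punct t) < M) ->
  \forall S' \near S, exists2 a, enorm a < e & pshift p a `<=` tiles S'.
Proof.
move=> e0 pS pM; rewrite /prop_near1 nbhsE.
exists [set S' : tiling | exists2 a, enorm a < e & pshift p a `<=` tiles S'] => //.
split; last by exists 0; rewrite ?enorm0// pshift0.
move=> S1 [a ae pS1].
(* For $g<1/f$: the 1 excludes the extra value 1 in [delta], the second term gives $2g<e-|a|$ for
   the motion $b-b'$, and the third keeps the moved punctures in the ball of agreement. *)
pose f := Num.max 1 (Num.max (2 / (e - enorm a)) (M + e + 1)).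
have f0 : 0 < f by rewrite lt_max ltr01.
exists f^-1; first by rewrite invr_gt0.
move=> S2 /inf_lt[|g]; first by exists 1; right.
have finv h : 0 < h -> h < f^-1 -> f < h^-1.
  by move=> h0 hf; rewrite -[f]invrK ltf_pV2 ?posrE ?invr_gt0.
case=> [[/andP[g0 g1] [b [b' [be be' agree]]]] gf|->]; last first.
  by rewrite ltNge invf_le1// le_max lexx.
have {gf} fg := finv _ g0 gf.
have ge : 2 * g < e - enorm a.
  have : 2 / (e - enorm a) < g^-1 by rewrite (le_lt_trans _ fg)// !le_max lexx orbT.
  rewrite ltr_pdivrMr ?subr_gt0//.
  by rewrite -[X in _ < X]/(g^-1 * _) ltr_pdivlMl// mulrC.
have gM : M + e + 1 < g^-1 by rewrite (le_lt_trans _ fg)// !le_max lexx !orbT.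
move: be be'; rewrite /eball/= !subr0 => be be'.
exists (a + b - b').
  rewrite (le_lt_trans (enormD _ _))// enormN.
  have := enormD a b; lra.
move=> _ [t pt <-]; apply/(pshift_tshift _ b'); rewrite tshiftD subrK.
rewrite -agree.
  by rewrite -tshiftD; apply/pshift_tshift/pS1/pshift_tshift.
rewrite /eball/= subr0; have := enormD (punct t) (a + b); have := enormD a b.
have := pM _ pt; lra.
Qed.

(** Some translate of [T 1] close to [S] contains a small translate of [p], and the small
    translation is absorbed in [b]. *)
Lemma hull_patch (S : tiling) p M : hull (T 1) S -> p `<=` S ->
  (forall t, p t -> enorm (punct t) < M) ->
  exists b, p `<=` pshift (T 1) b.
Proof.
move=> hS pS pM.
have [S' [[c S'E] [a _ pS']]] := hS _ (nbhs_patch ltr01 pS pM).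
exists (c - a) => t pt; rewrite -pshiftD -S'E.
by apply/pshiftE; rewrite opprK; apply/pS'/pshift_tshift.
Qed.

Lemma hull_tile (S : tiling) t : hull (T 1) S -> tiles S t ->
  exists b, tiles (T 1) (tshift t b).
Proof.
move=> hS St; have [|_ ->|b tb] := @hull_patch S [set t] (enorm (punct t) + 1) hS.
- by move=> _ ->.
- by rewrite ltrDl.
by exists (- b); apply/pshiftE; apply: tb.
Qed.

Definition hitting (S : set tile) M : set tile := [set t | S t /\ hits t M].

Lemma hitting_cover (S : tiling) M : eball 0 M `<=` psupport (hitting S M).
Proof.
move=> z; rewrite /eball/= subr0 => zM.
have [t St tz] : psupport S z by have [_ _ _ ->] := tilingP S.
by exists t => //; split=> //; exists z.
Qed.

(** Tiles of a tiling in the hull are translates of tiles of [T 1], whose outer radii are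
    bounded. *)
Lemma hitting_bounded (S : tiling) M : hull (T 1) S ->
  exists M', forall t, hitting S M t -> enorm (punct t) < M'.
Proof.
move=> hS; have [K K0 TK] := outer_ball T_proper 0; exists (M + K).
move=> t [St [z tz zM]]; have [b Tt] := hull_tile hS St.
have := TK _ Tt (z + b); rewrite supp_tshiftE addrK => /(_ tz) /=.
rewrite opprD addrACA subrr addr0 => zK.
rewrite -[punct t](subrK z) addrC (le_lt_trans (enormD _ _))//.
by rewrite ltr_leD// enormB.
Qed.

(* A tiling close to [S] contains a small translate of [p]; in the transversal
   the translation is 0, as punctures are at distance at least [r 1]. *)
Lemma transversal_patch (S : Xi) p M : p `<=` tiles (set_val S) ->
  (forall t, p t -> enorm (punct t) < M) -> (exists2 t, p t & punct t = 0) ->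
  \forall S' \near S, p `<=` tiles (set_val S').
Proof.
move=> pS pM [t0 pt0 t00].
have nS := @initial_continuous _ _ set_val S _ (nbhs_patch (r_gt0 T_proper 0) pS pM).
apply: (@filterS _ (nbhs S) _ _ _ _ nS) => S' [a ar pS'].
have [hS' [t' S't' t'0]] := set_valP S'; have [b Tt'] := hull_tile hS' S't'.
have ball_t' : eball 0 (r 1) `<=` (supp t')°.
  rewrite -open_subsetE; last exact: eball_open.
  move=> z; rewrite /eball/= subr0 => zr.
  rewrite -(addrK b z) -supp_tshiftE; apply: (inner_ball Tt').
  by rewrite /= t'0 add0r addrK.
have S't0 : tiles (set_val S') (tshift t0 a) by apply: pS'; exact/pshift_tshift.
have t0t' : tshift t0 a = t'.
  apply: (tiling_overlap (tilingP (set_val S'))) => //; exists a; split.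
    have [_ /(_ _ S't0)[_ _ ]] := tilingP (set_val S').
    by rewrite /= t00 add0r.
  by apply: ball_t'; rewrite /eball/= subr0.
have a0 : a = 0 by rewrite -t'0 -t0t' /= t00 add0r.
by move: pS'; rewrite a0 pshift0.
Qed.

Lemma hitting_origin (S : Xi) M : 0 < M ->
  exists2 t, hitting (set_val S) M t & punct t = 0.
Proof.
move=> M0; have [_ [t St t0]] := set_valP S; exists t => //; split=> //.
apply: hits_punct; last by rewrite t0 enorm0.
by have [_ /(_ _ St)] := tilingP (set_val S).
Qed.

(** If all neighbourhoods of [S] and [S'] meet, some [S1] contains the patches of both that hit a
    given ball; these patches then coincide. *)
Lemma transversal_hausdorff : hausdorff_space Xi.
Proof.
have sub (S S' : Xi) M : 1 <= M -> cluster (nbhs S) S' ->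
    hitting (set_val S) M `<=` tiles (set_val S').
  move=> M1 SS'; have M0 : 0 < M by rewrite (lt_le_trans _ M1).
  have near_hit (S0 : Xi) : \forall S1 \near S0,
      hitting (set_val S0) M `<=` tiles (set_val S1).
    have [hS _] := set_valP S0; have [M' M'P] := hitting_bounded M hS.
    by apply: transversal_patch M'P (hitting_origin S0 M0) => t [].
  have [S1 [SS1 S'S1]] := SS' _ _ (near_hit S) (near_hit S').
  move=> t SMt; have [_ tM] := SMt.
  suff [] : hitting (set_val S') M t by [].
  apply: (cover_mem (tilingP (set_val S1)) S'S1 (SS1 _ SMt)
    (@eball_open _ _ 0 M)); first exact: hitting_cover.
  exact: hits_eball.
move=> S S' SS'; apply/val_inj/tiling_eq/seteqP.
(* A positive radius ensures that the patch contains the tile with its puncture at 0. *)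
have max1 (M : R) : 1 <= Num.max 1 M by rewrite le_max lexx.
have maxM (M : R) : M <= Num.max 1 M by rewrite le_max lexx orbT.
have S'S : cluster (nbhs S') S by move=> A B S'A SB; rewrite setIC; exact: SS'.
split; apply: tiling_subset (tilingP _) _ => M.
- exists (hitting (set_val S) (Num.max 1 M)); split; first by move=> t [].
    exact: sub (max1 M) SS'.
  by apply: (subset_trans _ (@hitting_cover _ _)); exact: eball_le.
- exists (hitting (set_val S') (Num.max 1 M)); split; first by move=> t [].
    exact: sub (max1 M) S'S.
  by apply: (subset_trans _ (@hitting_cover _ _)); exact: eball_le.
Qed.

Definition phi_to_transversal (x : dB) : Xi :=
  exist _ (phi x) (mem_set (phi_transversal T_nested T_proper x)).

(** Paths with a long common prefix have images sharing a patch that covers a large ball. *)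
Lemma phi_continuous : continuous phi_to_transversal.
Proof.
apply: continuous_comp_initial => x A /= /nbhs_cover[M MA].
have [k Mk] := r_unbounded T_proper M.
apply: filterS (nbhs_path_prefix x k.+1) => y yx.
have [C xC] := path_chain_exists x.
have [C' yC'] := path_chain_exists y.
apply: MA (phi_patch T_nested T_proper xC (k := k)) _ _.
  by rewrite -(path_patchE k xC) -yx (path_patchE k yC'); exact: phi_patch.
have [Cc _] := xC; apply: (subset_trans _ (chain_patch_cover T_nested Cc)).
exact/eball_le/ltW.
Qed.

(* The image of [phi] is closed, and it is dense because each translate of
   [T 1] that has a tile punctured at 0 is the bottom of a tower. *)
Lemma phi_surjective (S : Xi) : exists x, phi_to_transversal x = S.
Proof.
have cl : closed (phi_to_transversal @` [set: dB]).
  apply: compact_closed transversal_hausdorff _.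
  apply: continuous_compact; last exact/compact_set_type/infinite_paths_compact.
  exact/continuous_subspaceT/phi_continuous.
suff [x _ <-] : (phi_to_transversal @` [set: dB]) S by exists x.
apply: cl => B [_ [[V oV <-] VS] VB].
have [M MV] := nbhs_cover (open_nbhs_nbhs (conj oV VS)).
have [hS _] := set_valP S; pose M1 := Num.max 1 M.
have [M' M'P] := hitting_bounded M1 hS.
have pS : hitting (set_val S) M1 `<=` set_val S by move=> t [].
have [b pb] := hull_patch hS pS M'P.
have [|s /pb sb s0] := @hitting_origin S M1; first by rewrite lt_max ltr01.
have [x [_ [_ xE _]]] := tower_path T_nested T_proper (tower_T T b) sb s0.
exists (phi_to_transversal x); split; first by exists x.
apply: VB; apply: (MV _ (hitting (set_val S) M1)) => //=; first by rewrite xE.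
apply: (subset_trans _ (@hitting_cover _ _)); apply: eball_le.
by rewrite le_max lexx orbT.
Qed.

End Topology.

(** * The homeomorphism of the two relations *)

Lemma initial_pair_continuous (X Y : choiceType) (U V W : topologicalType)
    (m : X -> U * W) (m' : Y -> V * W) (u : U -> V) (F : X -> Y) :
  continuous u -> (forall x, m' (F x) = (u (m x).1, (m x).2)) ->
  continuous (F : initial_topology m -> initial_topology m').
Proof.
move=> uc mF; apply: continuous_comp_initial.
rewrite (_ : m' \o F = (fun z => (u z.1, z.2)) \o m); last exact/funext.
move=> x; apply: (@continuous_comp (initial_topology m)).
  exact: initial_continuous.
apply: cvg_pair; last exact: cvg_snd.
by apply: continuous_comp; [exact: cvg_fst|exact: uc].
Qed.

Theorem theorem3p22 (R : realType) (d : nat) (L : Type)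
    (T : nat -> tiling R d L)
    (T_nested : nested_sequence T) (T_proper : proper_sequence T)
    (phi_inj : injective (@phi R d L T)) :
  exists F : R_diagram_space T -> R_transversal_space (T 1),
    homeomorphism F /\
    forall z : set_type (@R_diagram R d L T),
      let w : set_type (@R_transversal R d L (T 1)) := F z in
      set_val (set_val w).1 = phi (set_val z).1 /\ set_val (set_val w).2 = phi (set_val z).2.
Proof.
pose f := phi_to_transversal T_nested T_proper.
have f_inj : injective f by move=> x y [/phi_inj].
have /choice[g gK] : forall S, exists x, f x = S by exact: phi_surjective.
have gE S : phi (g S) = set_val S by rewrite -[in RHS](gK S).
have fK : cancel f g by move=> x; apply: f_inj; exact: gK.
have g_cont : continuous g.
  apply/continuous_closedP => A clA.
  (* A closed set of paths is compact, so its image under [f] is closed in the Hausdorff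
     transversal. *)
  have -> : g @^-1` A = f @` A.
    by apply/seteqP; split => [S AS|_ [x Ax <-]]; [exists (g S)|rewrite /= fK].
  apply: compact_closed; first exact: transversal_hausdorff.
  apply: continuous_compact.
    exact/continuous_subspaceT/phi_continuous.
  apply: (subclosed_compact clA (compact_set_type _)) => //.
  exact: infinite_paths_compact.
have FP (z : set_type (@R_diagram R d L T)) :
    R_transversal (S := T 1%N) (f (set_val z).1, f (set_val z).2).
  exact: path_equiv_translate (set_valP z).
have GP (w : set_type (@R_transversal R d L (T 1%N))) :
    R_diagram (T := T) (g (set_val w).1, g (set_val w).2).
  have [a wa] := set_valP w.
  apply: (translate_path_equiv T_nested T_proper (a := a) phi_inj).
  by rewrite /= !gE.
pose F z := exist (fun u => u \in @R_transversal R d L (T 1%N)) _ (mem_set (FP z)) :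
  R_transversal_space (T 1%N).
pose G w := exist (fun u => u \in @R_diagram R d L T) _ (mem_set (GP w)) :
  R_diagram_space T.
have F_cont : continuous (F : R_diagram_space T -> R_transversal_space (T 1%N)).
  exact: (initial_pair_continuous (@phi_continuous _ _ _ _ T_nested T_proper)).
(* [G] keeps the translation vector because [phi (g S)] is the tiling [S]. *)
have G_cont : continuous (G : R_transversal_space (T 1%N) -> R_diagram_space T).
  by apply: (initial_pair_continuous g_cont) => w; rewrite /= !gE.
exists F; split=> //; split=> //; exists G; split=> //.
- by move=> [[x y] xy]; apply: val_inj; rewrite /= !fK.
- by move=> [[x y] xy]; apply: val_inj; rewrite /= !gK.
Qed.
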